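(* Let $\mathcal{R}$ be a linear recurrence relation of degree $d\in\mathbb{N}$ with kernel $\mathbf{a}\in\mathbb{C}^d$, and let $\eta_{\mathcal{R}}(\mathbf{s};\cdot)$ be the recursive string determined by $\mathbf{a}$, initial conditions $\mathbf{s}=(s_0,\ldots,s_{d-1})\in\mathbb{C}^d$, gaps $\mathbf{g}=(g_1,\ldots,g_K)\in(0,\infty)^K$ and multiplicative generator $0<r<1$. Then there exist a generalized lattice string $\eta$ and an entire function $h_{\mathcal{R}}(\mathbf{s};\cdot)$ such that, after meromorphic continuation, $$\zeta_{\mathcal{R}}(\mathbf{s};s)=h_{\mathcal{R}}(\mathbf{s};s)\,\zeta_\eta(s)\qquad\text{for all } s\in\mathbb{C}.$$ Moreover, $D_{\mathcal{R}}(\mathbf{s})=D_\eta$ and $\mathcal{D}_{\mathcal{R}}(\mathbf{s})\subset\mathcal{D}_\eta$.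
   Context: $\mathbb{N}=\{1,2,3,\ldots\}$; $\delta_{\{x\}}$ denotes the Dirac mass at $x$. A sequence $\{s_n\}_{n=0}^\infty\subset\mathbb{C}$ satisfies the linear recurrence relation $\mathcal{R}$ of degree $d$ with kernel $\mathbf{a}=(a_1,\ldots,a_d)$, $a_d\ne0$, if $s_n=a_1s_{n-1}+\cdots+a_ds_{n-d}$ for all $n\ge d$; its initial conditions are $(s_0,\ldots,s_{d-1})$. The recursive string determined by $\mathbf{a},\mathbf{s},\mathbf{g},r$ is the local complex measure on $(0,\infty)$ $$\eta_{\mathcal{R}}(\mathbf{s};\cdot)=\sum_{k=1}^K\sum_{n=0}^\infty s_n\,\delta_{\{g_k^{-1}r^{-n}\}},$$ where $\{s_n\}$ is the sequence with initial conditions $\mathbf{s}$ satisfying $\mathcal{R}$. Generalized self-similar string: given $L,N\in\mathbb{N}$, gaps $(h_1,\ldots,h_L)\in(0,\infty)^L$, initial scaling ratios $(r_1,\ldots,r_N)\in(0,1)^N$ and initial multiplicities $(m_1,\ldots,m_N)\in\mathbb{C}^N$, it is the measure $\eta=\sum_{l=1}^L\sum_{J\in\mathscr{J}}m_J\,\delta_{\{h_l^{-1}r_J^{-1}\}}$, where $\mathscr{J}$ is the set of all finite words $J=j_1\cdots j_q$ ($q\ge0$) in the letters $1,\ldots,N$, $r_J=\prod_i r_{j_i}$, $m_J=\prod_i m_{j_i}$, and $r_J=m_J=1$ for the empty word. It is a generalized lattice string if there exist $0<\rho<1$ and positive integers $k_j$ with $r_j=\rho^{k_j}$ for each $j=1,\ldots,N$.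 For a local complex measure $\eta$ on $(0,\infty)$ supported away from $0$, with total variation $|\eta|$: the dimension is $D_\eta=\inf\{\sigma\in\mathbb{R}:\int_0^\infty x^{-\sigma}|\eta|(dx)<\infty\}\in[-\infty,\infty]$; the geometric zeta function is $\zeta_\eta(s)=\int_0^\infty x^{-s}\eta(dx)$ for $\mathrm{Re}(s)>D_\eta$. The geometric zeta functions of recursive strings and of generalized self-similar strings extend meromorphically to $\mathbb{C}$; the extensions are denoted by the same symbols, and the set of complex dimensions $\mathcal{D}_\eta$ is the set of poles in $\mathbb{C}$ of this extension. Finally $\zeta_{\mathcal{R}}(\mathbf{s};\cdot)$, $D_{\mathcal{R}}(\mathbf{s})$, $\mathcal{D}_{\mathcal{R}}(\mathbf{s})$ denote the geometric zeta function, dimension and set of complex dimensions of $\eta_{\mathcal{R}}(\mathbf{s};\cdot)$. *)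

(* Defs.v *)
From HB Require Import structures.
From mathcomp Require Import all_boot all_order all_algebra.
From mathcomp Require Import all_classical all_reals all_analysis.
From mathcomp Require Import complex.

Set Implicit Arguments.
Unset Strict Implicit.
Unset Printing Implicit Defensive.

Import Order.TTheory GRing.Theory Num.Theory.
Import numFieldNormedType.Exports.

Local Open Scope classical_set_scope.
Local Open Scope complex_scope.
Local Open Scope ring_scope.

(* A local complex measure on (0, oo) is a complex-valued set function whose
   restriction to each bounded Borel subset is a complex measure.  It is
   encoded as eta : set R -> R[i]; only its values on the bounded Borel subsets
   of (0, oo) are meaningful, and only those are used below. *)
Section LocalMeasures.
Variable R : realType.

Definition bounded_borel (A : set R) : Prop :=
  measurable (A : set (measurableTypeR R)) /\ exists M : R, A `<=` `]0, M]%classic.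

Definition variation_measure (eta : set R -> R[i]) (E : set R) : \bar R :=
  ereal_sup [set x | exists (n : nat) (A : 'I_n -> set R),
    [/\ forall i, bounded_borel (A i) /\ A i `<=` E,
        trivIset setT A
      & x = (\sum_(i < n) complex.Re `|eta (A i)|)%:E]].

(* Positive and negative parts of the Jordan decomposition.  If nu is the real
   or imaginary part of a local complex measure, these are positive measures
   on (0, oo), possibly of infinite mass. *)
Definition pos_variation (nu : set R -> R) (E : set R) : \bar R :=
  ereal_sup [set (nu A)%:E | A in [set A | bounded_borel A /\ A `<=` E]].

Definition neg_variation (nu : set R -> R) (E : set R) : \bar R :=
  pos_variation (fun A => - nu A) E.

(* The library integral is defined for an arbitrary set function mu; it is
   used below only with the variations above. *)
Definition integral_pos (mu : set R -> \bar R) (u : R -> R) : \bar R :=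
  integral (T := measurableTypeR R) mu `]0, +oo[%classic (fun x => (u x)%:E).

Definition integral_signed (nu : set R -> R) (u : R -> R) : R :=
  fine (integral_pos (pos_variation nu) u)
  - fine (integral_pos (neg_variation nu) u).

Definition integral_complex (eta : set R -> R[i]) (f : R -> R[i]) : R[i] :=
  let I (u : R -> R) : R[i] :=
    integral_signed (fun A => complex.Re (eta A)) u
    +i* integral_signed (fun A => complex.Im (eta A)) u in
  I (fun x => complex.Re (f x)) + 'i%C * I (fun x => complex.Im (f x)).

(* x ^ s = exp (s * ln x), for x > 0 *)
Definition cpow (x : R) (s : R[i]) : R[i] :=
  (expR (complex.Re s * ln x) * cos (complex.Im s * ln x))
  +i* (expR (complex.Re s * ln x) * sin (complex.Im s * ln x)).

Definition dimension (eta : set R -> R[i]) : \bar R :=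
  ereal_inf [set sigma%:E | sigma in [set sigma : R |
    (integral_pos (variation_measure eta) (fun x => powR x (- sigma)) < +oo)%E]].

Definition geometric_zeta (eta : set R -> R[i]) (s : R[i]) : R[i] :=
  integral_complex eta (fun x => cpow x (- s)).

End LocalMeasures.

Section Meromorphic.
Variable R : realType.
Local Notation C := (R[i]^o).

Definition entire (f : R[i] -> R[i]) : Prop :=
  forall z : C, derivable (f : C -> C) z 1.

Definition holomorphic_at (f : R[i] -> R[i]) (z : R[i]) : Prop :=
  \forall w \near (z : C), derivable (f : C -> C) w 1.

Definition pole (f : R[i] -> R[i]) (z : R[i]) : Prop :=
  (\forall w \near ((z : C)^'), derivable (f : C -> C) w 1) /\
  (complex.Re `|f w| @[w --> ((z : C)^')] --> +oo).

(* Isolated singularities only: essential ones are excluded, since a pole is a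
   point where |f| tends to infinity.  The value of a meromorphic function at its poles is irrelevant; removable
   singularities are required to be removed. *)
Definition meromorphic (f : R[i] -> R[i]) : Prop :=
  forall z : R[i], holomorphic_at f z \/ pole f z.

(* By the identity theorem F is determined by eta up to its (irrelevant)
   values at the poles; in particular the set of poles of F, which is the
   set of complex dimensions of eta, is determined by eta. *)
Definition zeta_continuation (eta : set R -> R[i]) (F : R[i] -> R[i]) : Prop :=
  meromorphic F /\
  forall s : R[i], (dimension eta < (complex.Re s)%:E)%E ->
    F s = geometric_zeta eta s.

End Meromorphic.

Section Recurrence.
Variables (K : nzRingType) (d : nat) (a s0 : d.-tuple K).

(* [:: s_(n-1); ...; s_0]; the coefficient a_(j+1) of the kernel is a`_j *)
Fixpoint recurrence_history (n : nat) : seq K :=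
  if n is m.+1 then
    let u := recurrence_history m in
    (if (m < d)%N then s0`_m else \sum_(j < d) a`_j * u`_j) :: u
  else [::].

Definition recurrence_seq (n : nat) : K := (recurrence_history n.+1)`_0.

Lemma recurrence_history_nth n j : (j < n)%N ->
  (recurrence_history n)`_j = recurrence_seq (n - j.+1).
Proof.
elim: n j => [//|n IH] [|j] jn; first by rewrite subSS subn0.
by rewrite subSS -IH.
Qed.

Lemma recurrence_seq_init n : (n < d)%N -> recurrence_seq n = s0`_n.
Proof. by move=> nd; rewrite /recurrence_seq /= nd. Qed.

Lemma recurrence_seq_rec n : (d <= n)%N ->
  recurrence_seq n = \sum_(j < d) a`_j * recurrence_seq (n - j.+1).
Proof.
move=> dn; rewrite /recurrence_seq [LHS]/= ltnNge dn /=.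
apply: eq_bigr => j _; congr (_ * _).
by apply: recurrence_history_nth; apply: leq_trans dn.
Qed.

End Recurrence.

(* The sums over infinite index sets below are finitely supported when
   evaluated at a bounded Borel subset E of (0, oo). *)
Section Strings.
Variable R : realType.

Definition recursive_string d K (a s0 : d.-tuple R[i]) (g : K.-tuple R) (r : R)
    (E : set R) : R[i] :=
  \sum_(k < K) \sum_(n \in [set: nat])
    recurrence_seq a s0 n * \1_E ((tnth g k)^-1 * r ^- n).

Definition self_similar_string L N (h : L.-tuple R) (r : N.-tuple R)
    (m : N.-tuple R[i]) (E : set R) : R[i] :=
  \sum_(l < L) \sum_(J \in [set: seq 'I_N])
    (\prod_(j <- J) tnth m j) *
    \1_E ((tnth h l)^-1 * (\prod_(j <- J) tnth r j)^-1).

Definition generalized_lattice_string (eta : set R -> R[i]) : Prop :=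
  exists (L N : nat) (h : L.-tuple R) (r : N.-tuple R) (m : N.-tuple R[i]),
    [/\ (0 < L)%N, (0 < N)%N,
        forall l, 0 < tnth h l,
        forall j, 0 < tnth r j < 1
      & (exists rho : R, 0 < rho < 1 /\
           forall j, exists2 k : nat, (0 < k)%N & tnth r j = rho ^+ k)
        /\ eta = self_similar_string h r m].

End Strings.

(* Main.v *)
Require Import Defs.
From mathcomp Require Import all_boot all_order all_algebra.
From mathcomp Require Import all_classical all_reals all_analysis.
From mathcomp Require Import measurable_realfun complex.
From mathcomp Require Import ring lra.

(** Grouping the gaps modulo powers of [r], write each [g_k] as [b r^n] with [b]
    in a window [(B r, B]]: the recursive string becomes a sum of strings
    [sum_n t_c(n) delta_(b_c^-1 r^-n)] with pairwise distinct atoms, each [t_c]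
    having a rational generating function [P_c / Q] where
    [Q = 1 - a_1 X - ... - a_d X^d].  Let [G] be the gcd of [Q] and the [P_c],
    [Q = G q], [P_c = G p_c], normalized so that [q(0) = 1].  By Bezout, [1/q] is
    a polynomial combination of [1] and the [t_c], so its power series converges
    absolutely exactly where all the [t_c] do.  The string [eta] with one gap [1],
    ratios [r^1, ..., r^d] and multiplicities the negated coefficients of [q] has
    zeta function [1/q(r^s)], hence the same dimension, and
    [zeta_R(s) = (sum_c b_c^s p_c(r^s)) zeta_eta(s)].

    The exponential polynomial [h(s) = sum_c b_c^s p_c(r^s)] may accidentally
    vanish at a zero of [q(r^s)], and then [zeta_R] has a removable singularity
    or a pole of lower order there; this is settled by comparing Taylor
    expansions of the exponential. *)

Set Implicit Arguments.
Unset Strict Implicit.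
Unset Printing Implicit Defensive.

Import Order.TTheory GRing.Theory Num.Theory.
Import numFieldNormedType.Exports.

Local Open Scope classical_set_scope.
Local Open Scope ring_scope.

(** * Formal power series and reduced fractions *)

Section FormalSeries.
Variable F : fieldType.
Implicit Types (p q : {poly F}) (u v : nat -> F).

(** The Cauchy product of [p] with the formal power series of coefficients [u]: sequences become a
    module over [{poly F}]. *)
Definition pconv p u : nat -> F := fun n => \sum_(i < n.+1) p`_i * u (n - i)%N.

Definition poly_series p : nat -> F := fun n => p`_n.

(** Later terms of [u] cannot reach the coefficient of index [n], so identities for [pconv] reduce
    to coefficients of genuine polynomial products. *)
Lemma pconv_trunc p u n m : (n < m)%N -> pconv p u n = (p * \poly_(i < m) u i)`_n.
Proof.
move=> nm; rewrite coefM; apply: eq_bigr => i _.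
by rewrite coef_poly (leq_ltn_trans (leq_subr _ _) nm).
Qed.

Lemma pconvDl p q u : pconv (p + q) u = pconv p u \+ pconv q u.
Proof.
apply/funext => n; rewrite /pconv /= -big_split/=.
by apply: eq_bigr => i _; rewrite coefD mulrDl.
Qed.

Lemma pconvC c u : pconv c%:P u = c \*o u.
Proof.
apply/funext => n; rewrite /pconv /= big_ord_recl coefC eqxx subn0 big1 ?addr0//.
by move=> i _; rewrite coefC mul0r.
Qed.

Lemma pconvM p q u : pconv (p * q) u = pconv p (pconv q u).
Proof.
apply/funext => n; rewrite (@pconv_trunc _ _ n n.+1)// -mulrA coefM.
apply: eq_bigr => i _; congr (_ * _).
by rewrite (@pconv_trunc _ _ _ n.+1)// ltnS leq_subr.
Qed.

Lemma pconv_poly_series p q : pconv p (poly_series q) = poly_series (p * q).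
Proof. by apply/funext => n; rewrite /poly_series coefM. Qed.

(** A polynomial with nonzero constant term is invertible as a power series. Once the earlier terms
    agree, the equation of index [n] reduces to its term in p(0), which can be cancelled. *)
Lemma pconv_inj p u v : p`_0 != 0 -> pconv p u = pconv p v -> u = v.
Proof.
move=> p0 pE; apply/funext => n; elim/ltn_ind: n => n IH.
have := congr1 (fun f => f n) pE; rewrite /pconv !big_ord_recl subn0.
rewrite (eq_bigr (fun i : 'I_n => p`_(lift ord0 i) * v (n - lift ord0 i)%N)).
  by move/addIr/(mulfI p0).
move=> i _; rewrite IH// lift0 ltn_subrL /=.
by case: n i {IH pE} => // -[].
Qed.

Lemma pconv_mulXS p u n : pconv (p * 'X) u n.+1 = pconv p u n.
Proof.
rewrite /pconv big_ord_recl coefMX eqxx mul0r add0r.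
by apply: eq_bigr => i _; rewrite coefMX lift0 subSS.
Qed.

Lemma pconv_mulX0 p u : pconv (p * 'X) u 0 = 0.
Proof. by rewrite /pconv big_ord_recl big_ord0 coefMX eqxx mul0r addr0. Qed.

(** Bezout's identity in the form that the gcd lies in every ideal containing the family; no
    cofactors have to be carried along. *)
Lemma common_divisor p (ps : seq {poly F}) : exists g : {poly F},
  [/\ g %| p, forall q, q \in ps -> g %| q &
  forall S : {poly F} -> Prop, (forall a b, S b -> S (a * b)) ->
    (forall a b, S a -> S b -> S (a + b)) ->
    S p -> (forall q, q \in ps -> S q) -> S g].
Proof.
elim: ps => [|q ps [g [gp gps gS]]]; first by exists p; split.
exists (gcdp g q); split.
- exact: dvdp_trans (dvdp_gcdl _ _) gp.
- move=> x; rewrite inE => /orP[/eqP ->|/gps]; first exact: dvdp_gcdr.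
  exact: dvdp_trans (dvdp_gcdl _ _).
- move=> S SM SD Sp Sps.
  have Sg : S g by apply: gS => // x xps; apply: Sps; rewrite inE xps orbT.
  have Sq : S q by apply: Sps; rewrite inE eqxx.
  have [[a b] /=] := Bezoutp g q.
  case/andP=> /dvdpP[c ->] _.
  by apply/SM/SD; exact/SM.
Qed.

(** With g the gcd of [q] and all [p i], Bezout writes g as a combination of [q] and the [p i];
    dividing by [q] makes g/q a combination of 1 and the series [t i]. Up to a constant g/q is [u],
    the inverse of the reduced denominator. The predicate [S] later stands for absolute convergence
    at a given point. *)
Lemma reduced_denominator (I : finType) q (t : I -> nat -> F) (p : I -> {poly F}) :
    q`_0 = 1 -> (forall i, pconv q (t i) = poly_series (p i)) ->
  exists (q' : {poly F}) (p' : I -> {poly F}),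
  [/\ (size q' <= size q)%N, q'`_0 = 1 &
    forall u, pconv q' u = poly_series 1 ->
    (forall i, t i = pconv (p' i) u) /\
    forall S : (nat -> F) -> Prop, (forall a y, S y -> S (pconv a y)) ->
      (forall y z, S y -> S z -> S (y \+ z)) -> S (poly_series 1) ->
      (forall i, S (t i)) -> S u].
Proof.
move=> q0 tE; have [g [/dvdpP[q1 qE] gp gS]] := common_divisor q (codom p).
have /fin_all_exists[p1 pE] : forall i, exists p1, p i = p1 * g.
  by move=> i; apply/dvdpP/gp/codom_f.
have g0q : q1`_0 * g`_0 = 1.
  by rewrite -q0 qE coefM big_ord_recl big_ord0 addr0.
have g0 : g`_0 != 0.
  by apply/eqP => g0; move/eqP: g0q; rewrite g0 mulr0 eq_sym oner_eq0.
have qn0 : q`_0 != 0 by rewrite q0 oner_eq0.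
(* As q(0) = 1, the constant terms of g and [q1] are inverse to each other; scaling by g(0)
   normalizes the new denominator. *)
exists (g`_0 *: q1), (fun i => g`_0 *: p1 i); split.
- rewrite size_scale// qE; have [->|q10] := eqVneq q1 0.
    by rewrite mul0r.
  apply: dvdp_leq; last exact: dvdp_mulr.
  by rewrite mulf_neq0//; apply: contraNneq g0 => ->; rewrite coef0.
- by rewrite coefZ mulrC.
move=> u uE; split=> [i|S SM SD S1 St].
  apply: (pconv_inj qn0); rewrite tE -pconvM pE.
  have -> : q * (g`_0 *: p1 i) = (p1 i * g) * (g`_0 *: q1).
    by rewrite qE -!scalerAr; congr (_ *: _); ring.
  by rewrite pconvM uE pconv_poly_series mulr1.
have [y Sy yE] : exists2 y, S y & pconv q y = poly_series g.
  (* The ideal in question: numerators a for which the series a/q satisfies [S]. *)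
  apply: (gS (fun a => exists2 y, S y & pconv q y = poly_series a)).
  - move=> a b [y Sy yE]; exists (pconv a y); first exact: SM.
    by rewrite -pconvM mulrC pconvM yE pconv_poly_series.
  - move=> a b [y Sy yE] [z Sz zE]; exists (y \+ z); first exact: SD.
    apply/funext => n; rewrite /poly_series coefD.
    move/(congr1 (@^~ n)): yE; move/(congr1 (@^~ n)): zE; rewrite /poly_series => <- <-.
    rewrite /pconv -big_split/=; apply: eq_bigr => i _; exact: mulrDr.
  - by exists (poly_series 1) => //; rewrite pconv_poly_series mulr1.
  - by move=> _ /codomP[i ->]; exists (t i).
have -> : u = pconv (g`_0)^-1%:P y.
  apply: (pconv_inj qn0); rewrite -pconvM mulrC pconvM yE.
  have -> : q = ((g`_0)^-1%:P * g) * (g`_0 *: q1).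
    rewrite qE -mul_polyC mulrACA -polyCM mulVf// mul1r; exact: mulrC.
  by rewrite pconvM uE !pconv_poly_series mulr1.
exact: SM.
Qed.

End FormalSeries.

(** * Complex moduli and absolutely convergent series *)

Section ComplexModulus.
Variable R : realType.
Local Notation C := (R[i]^o).
Implicit Types z w : R[i].

(** The norm of [R[i]] takes values in [R[i]]; this is the same modulus as a real number. *)
Definition cabs z : R := complex.Re `|z|.

Lemma normc_cabs z : `|z| = ((cabs z)%:C)%C.
Proof. by rewrite /cabs normc_def. Qed.

Lemma cabsE z : cabs z = Num.sqrt (complex.Re z ^+ 2 + complex.Im z ^+ 2).
Proof. by rewrite /cabs normc_def. Qed.

Lemma cabs_ge0 z : 0 <= cabs z.
Proof. by rewrite cabsE sqrtr_ge0. Qed.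

Lemma cabsM z w : cabs (z * w) = cabs z * cabs w.
Proof.
by apply/(@complexI R); rewrite -normc_cabs normrM !normc_cabs rmorphM.
Qed.

Lemma cabsD z w : cabs (z + w) <= cabs z + cabs w.
Proof. by rewrite -lecR rmorphD /= -!normc_cabs; exact: ler_normD. Qed.

Lemma cabsN z : cabs (- z) = cabs z.
Proof. by rewrite /cabs normrN. Qed.

Lemma cabs0 : cabs 0 = 0.
Proof. by rewrite /cabs normr0. Qed.

Lemma cabs1 : cabs 1 = 1.
Proof. by rewrite /cabs normr1. Qed.

Lemma cabs_eq0 z : (cabs z == 0) = (z == 0).
Proof.
by rewrite -[RHS]normr_eq0 normc_cabs; apply/eqP/eqP => [->//|[]].
Qed.

Lemma cabsV z : cabs z^-1 = (cabs z)^-1.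
Proof.
by apply/(@complexI R); rewrite -normc_cabs normfV !normc_cabs fmorphV.
Qed.

Lemma cabsX z n : cabs (z ^+ n) = cabs z ^+ n.
Proof. by elim: n => [|n IH]; rewrite ?expr0 ?cabs1// !exprS cabsM IH. Qed.

Lemma cabs_sum n (f : 'I_n -> R[i]) : cabs (\sum_i f i) <= \sum_i cabs (f i).
Proof.
elim/big_ind2: _ => //; first by rewrite cabs0.
by move=> x x' y y' xx' yy'; apply: le_trans (cabsD _ _) (lerD _ _).
Qed.

Lemma Re_le_cabs z : `|complex.Re z| <= cabs z.
Proof. by rewrite cabsE -sqrtr_sqr ler_wsqrtr// lerDl sqr_ge0. Qed.

Lemma Im_le_cabs z : `|complex.Im z| <= cabs z.
Proof. by rewrite cabsE -sqrtr_sqr ler_wsqrtr// lerDr sqr_ge0. Qed.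

Lemma cabs_le_ReIm z : cabs z <= `|complex.Re z| + `|complex.Im z|.
Proof.
rewrite cabsE -(ger0_norm (addr_ge0 (normr_ge0 _) (normr_ge0 _))) -sqrtr_sqr.
rewrite ler_wsqrtr// sqrrD !real_normK ?num_real// addrAC lerDl.
by rewrite mulrn_wge0// mulr_ge0.
Qed.

Lemma cabs_real (x : R) : cabs (x%:C)%C = `|x|.
Proof. by rewrite cabsE /= expr0n/= addr0 sqrtr_sqr. Qed.

Lemma Re_sum I (s : seq I) (P : pred I) (f : I -> R[i]) :
  complex.Re (\sum_(i <- s | P i) f i) = \sum_(i <- s | P i) complex.Re (f i).
Proof. by apply: big_morph => // -[a b] [c e]. Qed.

Lemma Im_sum I (s : seq I) (P : pred I) (f : I -> R[i]) :
  complex.Im (\sum_(i <- s | P i) f i) = \sum_(i <- s | P i) complex.Im (f i).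
Proof. by apply: big_morph => // -[a b] [c e]. Qed.

Lemma ReB z w : complex.Re (z - w) = complex.Re z - complex.Re w.
Proof. by case: z w => a b []. Qed.

Lemma ImB z w : complex.Im (z - w) = complex.Im z - complex.Im w.
Proof. by case: z w => a b []. Qed.

Lemma ReD z w : complex.Re (z + w) = complex.Re z + complex.Re w.
Proof. by case: z w => a b []. Qed.

Lemma ImD z w : complex.Im (z + w) = complex.Im z + complex.Im w.
Proof. by case: z w => a b []. Qed.

Lemma cvg_complex T (F : set_system T) (FF : Filter F) (f : T -> R[i]) (l : R[i]) :
  (fun t => complex.Re (f t)) @ F --> complex.Re l ->
  (fun t => complex.Im (f t)) @ F --> complex.Im l ->
  (f : T -> C) @ F --> (l : C).
Proof.
move=> /cvgrPdist_lt cRe /cvgrPdist_lt cIm; apply/cvgrPdist_lt => /= e.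
move=> /[dup] e_gt0; rewrite ltcE /= => /andP[/eqP e0 e1].
have e2 : 0 < complex.Re e / 2 by rewrite divr_gt0.
have eE : e = ((complex.Re e)%:C)%C by rewrite [LHS]complexE e0 mulr0 addr0.
move: (cRe _ e2) (cIm _ e2); apply: filterS2 => t Re_t Im_t.
rewrite eE normc_cabs ltcR (le_lt_trans (cabs_le_ReIm _))//.
by rewrite (splitr (complex.Re e)) ReB ImB ltrD.
Qed.

End ComplexModulus.

Section Summation.
Variable R : realType.
Local Notation C := (R[i]^o).
Implicit Types f g : nat -> R[i].

Definition abs_summable f :=
  exists B : R, forall N, \sum_(n < N) cabs (f n) <= B.

Definition has_sum f (l : R[i]) :=
  (fun N : nat => (\sum_(n < N) f n : C)) @ \oo --> (l : C).

Lemma abs_summable_le f g (c : R) : 0 <= c -> (forall n, cabs (f n) <= c * cabs (g n)) ->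
  abs_summable g -> abs_summable f.
Proof.
move=> c0 fg [B gB]; exists (c * B) => N.
apply: le_trans (ler_wpM2l c0 (gB N)).
by rewrite mulr_sumr ler_sum.
Qed.

Lemma abs_summable_eq f g : f =1 g -> abs_summable f -> abs_summable g.
Proof. by move=> /funext ->. Qed.

Lemma has_sum_eq f g l : f =1 g -> has_sum f l -> has_sum g l.
Proof. by move=> /funext ->. Qed.

Lemma abs_summableD f g : abs_summable f -> abs_summable g -> abs_summable (f \+ g).
Proof.
move=> [A fA] [B gB]; exists (A + B) => N.
apply: le_trans (lerD (fA N) (gB N)); rewrite -big_split/= ler_sum// => i _.
exact: cabsD.
Qed.

Lemma abs_summableZ c f : abs_summable f -> abs_summable (c \*o f).
Proof.
by apply: (@abs_summable_le _ _ (cabs c)) => [|n]; rewrite ?cabs_ge0//= cabsM.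
Qed.

Lemma abs_summableS f : abs_summable (fun n => f n.+1) -> abs_summable f.
Proof.
move=> [B fB]; exists (cabs (f 0%N) + B) => -[|N].
  by rewrite big_ord0 addr_ge0 ?cabs_ge0//; have := fB 0%N; rewrite big_ord0.
by rewrite big_ord_recl lerD2l (le_trans _ (fB N)).
Qed.

Lemma abs_summable_finite f N : (forall n, (N <= n)%N -> f n = 0) -> abs_summable f.
Proof.
elim: N f => [|N IH] f f0.
  by exists 0 => M; rewrite big1// => i _; rewrite f0// cabs0.
by apply: abs_summableS; apply: IH => n Nn; rewrite f0.
Qed.

Lemma has_sum_unique f a b : has_sum f a -> has_sum f b -> a = b.
Proof. by move=> fa fb; exact: (@norm_cvg_unique _ C _ _ _ _ fa fb). Qed.

Lemma has_sumD f g a b : has_sum f a -> has_sum g b -> has_sum (f \+ g) (a + b).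
Proof.
move=> fa gb; rewrite /has_sum.
under eq_fun do rewrite big_split.
exact: (@cvgD _ C _ _ _ _ _ _ _ fa gb).
Qed.

Lemma has_sumZ c f a : has_sum f a -> has_sum (c \*o f) (c * a).
Proof.
move=> fa; rewrite /has_sum.
under eq_fun do rewrite -mulr_sumr.
exact: (@cvgZl_tmp _ C _ _ _ (c : R[i]) _ _ fa).
Qed.

Lemma has_sumS f a : has_sum (fun n => f n.+1) a -> has_sum f (f 0%N + a).
Proof.
move=> fa; rewrite /has_sum -cvg_shiftS /=.
under eq_fun do (rewrite big_ord_recl; under eq_bigr do rewrite lift0).
exact: (@cvgD _ C _ _ _ _ _ _ _ (@cvg_cst C _ _ _ _) fa).
Qed.

Lemma has_sum_finite f N : (forall n, (N <= n)%N -> f n = 0) ->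
  has_sum f (\sum_(n < N) f n).
Proof.
elim: N f => [|N IH] f f0.
  rewrite big_ord0 /has_sum.
  under eq_fun do (rewrite big1; [|by move=> i _; rewrite f0]).
  exact: (@cvg_cst C).
rewrite big_ord_recl; apply: has_sumS.
under eq_bigr do rewrite lift0.
by apply: (IH (fun n => f n.+1)) => n Nn; rewrite f0.
Qed.

(** Horner induction on [p]: multiplication by ['X] shifts the series one place and multiplies its
    terms by [z]. *)
Lemma abs_summable_pconv (p : {poly R[i]}) (u : nat -> R[i]) (z : R[i]) :
  abs_summable (fun n => u n * z ^+ n) -> abs_summable (fun n => pconv p u n * z ^+ n).
Proof.
move=> ua; elim/poly_ind: p => [|p c IH].
  apply: (@abs_summable_finite _ 0) => n _.
  by rewrite /pconv big1 ?mul0r// => i _; rewrite coef0 mul0r.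
apply: (@abs_summable_eq ((fun n => pconv (p * 'X) u n * z ^+ n) \+
    (c \*o (fun n => u n * z ^+ n)))) => [n|].
  by rewrite pconvDl pconvC /= mulrDl mulrA.
apply: abs_summableD; last exact: abs_summableZ.
apply: abs_summableS.
apply: (@abs_summable_eq (z \*o (fun n => pconv p u n * z ^+ n))) => [n|].
  by rewrite pconv_mulXS exprS /=; ring.
exact: abs_summableZ.
Qed.

(** The same Horner induction. One factor is a polynomial, so plain convergence of the other series
    is enough. *)
Lemma has_sum_pconv (p : {poly R[i]}) (u : nat -> R[i]) (z a : R[i]) :
  has_sum (fun n => u n * z ^+ n) a ->
  has_sum (fun n => pconv p u n * z ^+ n) (p.[z] * a).
Proof.
move=> us; elim/poly_ind: p => [|p c IH].
  have E n : pconv 0 u n * z ^+ n = 0.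
    by rewrite /pconv big1 ?mul0r// => i _; rewrite coef0 mul0r.
  have := @has_sum_finite (fun n => pconv 0 u n * z ^+ n) 0 (fun n _ => E n).
  by rewrite big_ord0 horner0 mul0r.
have -> : (p * 'X + c%:P).[z] * a = (0 + z * (p.[z] * a)) + c * a.
  by rewrite hornerMXaddC; ring.
apply: (@has_sum_eq ((fun n => pconv (p * 'X) u n * z ^+ n) \+
    (c \*o (fun n => u n * z ^+ n)))) => [n|].
  by rewrite pconvDl pconvC /= mulrDl mulrA.
apply: has_sumD; last exact: has_sumZ.
rewrite -[0](mul0r (z ^+ 0)) -(pconv_mulX0 p u).
apply: (@has_sumS (fun n => pconv (p * 'X) u n * z ^+ n)).
apply: (@has_sum_eq (z \*o (fun n => pconv p u n * z ^+ n))) => [n|].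
  by rewrite pconv_mulXS exprS /=; ring.
exact: has_sumZ.
Qed.

Lemma blocked_sum (V : zmodType) (k : nat) (F : nat -> V) N :
  \sum_(m < N * k) F m = \sum_(n < N) \sum_(c < k) F (n * k + c)%N.
Proof.
elim: N => [|N IH]; first by rewrite mul0n !big_ord0.
rewrite big_ord_recr /= -IH -!(big_mkord xpredT F) mulSnr.
rewrite (big_cat_nat (n := N * k))//= ?leq_addr//; congr (_ + _).
rewrite -{1}(add0n (N * k)%N) big_addn addKn big_mkord.
by apply: eq_bigr => i _; rewrite addnC.
Qed.

(** Finitely many strings are interleaved into one sequence, with index [n * k + c] for the term [n]
    of string [c]; this lemma and [has_sum_blocks] separate them again. *)
Lemma abs_summable_blocks (k : nat) f : (0 < k)%N ->
  abs_summable f <-> (forall c : 'I_k, abs_summable (fun n => f (n * k + c)%N)).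
Proof.
move=> k0; split.
- move=> [B fB] c; exists B => N; apply: le_trans (fB (N * k)%N).
  rewrite (blocked_sum k (fun n => cabs (f n))) ler_sum// => n _.
  by rewrite (bigD1 c)//= lerDl sumr_ge0// => i _; exact: cabs_ge0.
- move=> /fin_all_exists[B fB]; exists (\sum_c B c) => N.
  (* Since the terms are nonnegative, the range may be rounded up to complete blocks. *)
  apply: (@le_trans _ _ (\sum_(n < N * k) cabs (f n))).
    have NNk : (N <= N * k)%N by rewrite leq_pmulr.
    rewrite (big_ord_widen (N * k) (fun n => cabs (f n)) NNk) [leRHS](bigID (fun i : 'I__ => (i < N)%N))/=.
    by rewrite lerDl sumr_ge0// => i _; exact: cabs_ge0.
  rewrite (blocked_sum k (fun n => cabs (f n))) exchange_big/= ler_sum// => c _.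
  exact: fB.
Qed.

(** The partial sums at multiples of [k] form a subsequence of those of [f], and each of them is a
    sum of partial sums of the [k] strings. *)
Lemma has_sum_blocks (k : nat) f a (b : 'I_k -> R[i]) : (0 < k)%N ->
  has_sum f a -> (forall c : 'I_k, has_sum (fun n => f (n * k + c)%N) (b c)) ->
  a = \sum_c b c.
Proof.
move=> k0 fa fb.
have h1 : (fun N : nat => (\sum_(n < N * k) f n : C)) @ \oo --> (a : C).
  apply: (cvg_comp (fun N => N * k)%N (fun N => \sum_(n < N) f n)) fa.
  move=> A [M _ MA]; exists M => // N /= MN; apply: MA => /=.
  by rewrite (leq_trans MN)// leq_pmulr.
have h2 : (fun N : nat => (\sum_(n < N * k) f n : C)) @ \oo --> (\sum_c b c : C).
  under eq_fun do rewrite blocked_sum exchange_big/=.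
  apply: (@cvg_big C); first exact: (@add_continuous C).
  by move=> c _; exact: fb.
exact: (@norm_cvg_unique _ C _ _ _ _ h1 h2).
Qed.

End Summation.

(** * Atomic local measures *)

Section BoundedSeries.
Variable R : realType.
Implicit Types f : nat -> R.

Lemma nneseries_ge_sum f N : (forall n, 0 <= f n) ->
  ((\sum_(n < N) f n)%:E <= \sum_(n <oo) (f n)%:E)%E.
Proof.
move=> f0; rewrite -sumEFin -(big_mkord xpredT (fun n => (f n)%:E)).
by apply: nneseries_lim_ge => n _ _; rewrite lee_fin.
Qed.

Lemma nneseries_fin f : (forall n, 0 <= f n) ->
  ((\sum_(n <oo) (f n)%:E < +oo)%E <->
   exists B : R, forall N, \sum_(n < N) f n <= B).
Proof.
move=> f0; have f0E n : (0 <= n)%N -> xpredT n -> (0 <= (f n)%:E)%E by rewrite lee_fin.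
split=> [foo|[B fB]].
  exists (fine (\sum_(n <oo) (f n)%:E)%E) => N.
  rewrite -lee_fin fineK ?nneseries_ge_sum//.
  by rewrite ge0_fin_numE// nneseries_ge0.
apply: le_lt_trans (ltry B); apply: lime_le.
  exact: is_cvg_nneseries.
by near=> N; rewrite big_mkord sumEFin lee_fin.
Unshelve. all: by end_near. Qed.

Lemma cvg_nneseries_fine f (B : R) : (forall n, 0 <= f n) ->
  (forall N, \sum_(n < N) f n <= B) ->
  (\sum_(n <oo) (f n)%:E)%E \is a fin_num /\
  (fun N : nat => \sum_(n < N) f n) @ \oo --> fine (\sum_(n <oo) (f n)%:E)%E.
Proof.
move=> f0 fB; have f0E n : (0 <= n)%N -> xpredT n -> (0 <= (f n)%:E)%E by rewrite lee_fin.
have ffin : (\sum_(n <oo) (f n)%:E)%E \is a fin_num.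
  by rewrite ge0_fin_numE ?nneseries_ge0//; apply/nneseries_fin => //; exists B.
split=> //; apply: (@fine_cvg _ _ _ _ (fun N : nat => (\sum_(n < N) f n)%:E)); rewrite fineK//.
under eq_fun do rewrite -sumEFin -(big_mkord xpredT (fun n => (f n)%:E)).
exact: (is_cvg_nneseries f0E).
Qed.

End BoundedSeries.

Section Atomic.
Variables (R : realType) (x : nat -> R).
Hypothesis x_gt0 : forall n, 0 < x n.
Hypothesis x_inj : injective x.

(** Equality for all large [N] expresses that only finitely many terms are nonzero on a bounded set,
    so no infinite sum occurs. *)
Definition atomic (V : pzRingType) (eta : set R -> V) (c : nat -> V) :=
  forall A, bounded_borel A -> exists N0 : nat, forall N, (N0 <= N)%N ->
    eta A = \sum_(n < N) c n * \1_A (x n).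

(** Finite test sets, by which the suprema defining the variations are approached from below. *)
Definition atoms (E : set R) (P : pred nat) (N : nat) : set R :=
  [set y | exists n, [/\ (n < N)%N, P n, E (x n) & y = x n]].

Lemma atomsE E P N n : atoms E P N (x n) <-> [/\ (n < N)%N, P n & E (x n)].
Proof.
split=> [[m [mN Pm Em /x_inj ->]]//|[nN Pn En]]; by exists n.
Qed.

Lemma bounded_borel_atoms E P N : bounded_borel (atoms E P N).
Proof.
split.
  have : finite_set (atoms E P N).
    apply: (@sub_finite_set _ _ (x @` `I_N)); last exact: finite_image.
    by move=> _ [n [nN _ _ ->]]; exists n.
  by move=> /finite_set_countable; apply: countable_measurable => t; exact: measurable_set1.
exists (\sum_(n < N) x n) => _ [n [nN _ _ ->]]; rewrite /= in_itv/= x_gt0/=.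
by rewrite (bigD1 (Ordinal nN))//= lerDl sumr_ge0// => i _; exact: ltW.
Qed.

Lemma indic_le1 (A B : set R) y : A `<=` B -> (\1_A y : R) <= \1_B y.
Proof.
move=> AB; rewrite !indicE; have [/set_mem Ay|] := boolP (y \in A); last first.
  by move=> _; rewrite ler0n.
by rewrite (mem_set (AB _ Ay)).
Qed.

(** Above: pass from [w] to its positive part and from [A] to [E]. Below: test with the first [N]
    atoms of positive weight. Injectivity of [x] is what lets a test set select individual
    weights. *)
Lemma pos_variation_atomic (nu : set R -> R) (w : nat -> R) (E : set R) :
  atomic nu w ->
  pos_variation nu E = (\sum_(n <oo) (Num.max (w n) 0 * \1_E (x n))%:E)%E.
Proof.
move=> nuw; have p0 n : 0 <= Num.max (w n) 0 * (\1_E (x n) : R).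
  by rewrite mulr_ge0// le_max lexx orbT.
apply/eqP; rewrite eq_le; apply/andP; split.
  apply: ge_ereal_sup => _ [A [bA AE] <-].
  have [N nuE] := nuw _ bA; rewrite (nuE N)//.
  apply: le_trans (nneseries_ge_sum N p0); rewrite lee_fin ler_sum// => n _.
  apply: (@le_trans _ _ (Num.max (w n) 0 * \1_A (x n))).
    by rewrite ler_wpM2r// le_max lexx.
  by rewrite ler_wpM2l ?indic_le1// le_max lexx orbT.
apply: lime_le.
  by apply: is_cvg_nneseries => n _ _; rewrite lee_fin.
near=> N; rewrite big_mkord sumEFin.
set A := atoms E (fun n => 0 < w n) N.
apply: (@le_trans _ _ (nu A)%:E); last first.
  apply: ereal_sup_ubound; exists A => //; split; first exact: bounded_borel_atoms.
  by move=> _ [n [_ _ En ->]].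
have [M0 nuE] := nuw _ (bounded_borel_atoms E (fun n => 0 < w n) N).
(* The cutoff [M0] of the test set may exceed [N]; the extra terms vanish, as the set contains only
   atoms of index below [N]. *)
rewrite (nuE (N + M0)%N) ?leq_addl// big_split_ord/= lee_fin.
rewrite [X in _ <= _ + X]big1 ?addr0; last first.
  move=> i _; rewrite indicE memNset ?mulr0// => /atomsE[].
  by rewrite ltnNge leq_addr.
apply: ler_sum => n _; rewrite !indicE.
have [wn|wn] := ltP 0 (w n); last by rewrite (le_trans _ (_ : 0 <= _)) ?mul0r//;
  rewrite memNset ?mulr0// => /atomsE[_]; rewrite ltNge wn.
rewrite ler_wpM2l ?(ltW wn)//; have [/set_mem En|] := boolP (x n \in E); last by rewrite ler0n.
by rewrite mem_set//; apply/atomsE.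
Unshelve. all: by end_near. Qed.

Lemma variation_atomic (eta : set R -> R[i]) (c : nat -> R[i]) (E : set R) :
  atomic eta c ->
  variation_measure eta E = (\sum_(n <oo) (cabs (c n) * \1_E (x n))%:E)%E.
Proof.
move=> etac; have p0 n : 0 <= cabs (c n) * (\1_E (x n) : R).
  by rewrite mulr_ge0// cabs_ge0.
have indC (A : set R) y : cabs (\1_A y : R[i]) = \1_A y.
  by rewrite !indicE; case: (_ \in _); rewrite ?cabs1 ?cabs0.
apply/eqP; rewrite eq_le; apply/andP; split.
  apply: ge_ereal_sup => _ [k [A [bA tA ->]]].
  have /fin_all_exists[N0 etaE] := fun i => etac _ (bA i).1.
  (* A cutoff valid for all pieces at once. *)
  pose N := (\sum_i N0 i)%N.
  have N0N i : (N0 i <= N)%N by rewrite /N (bigD1 i)//= leq_addr.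
  apply: le_trans (nneseries_ge_sum N p0); rewrite lee_fin.
  apply: (@le_trans _ _ (\sum_i \sum_(n < N) cabs (c n) * \1_(A i) (x n))).
    apply: ler_sum => i _; rewrite (etaE i _ (N0N i)).
    apply: le_trans (cabs_sum _) _; apply: ler_sum => n _.
    by rewrite cabsM indC.
  rewrite exchange_big/= ler_sum// => n _; rewrite -mulr_sumr.
  rewrite ler_wpM2l ?cabs_ge0//.
  have [[i Ai]|nA] := pselect (exists i, A i (x n)).
    rewrite (bigD1 i)//= big1 ?addr0 ?indic_le1//; first exact: (bA i).2.
    move=> j ji; rewrite indicE memNset// => Aj.
    by move/eqP: ji; apply; apply: (tA j i) => //; exists (x n).
  rewrite big1 => [|i _]; first by rewrite indicE ler0n.
  by rewrite indicE memNset// => Ai; apply: nA; exists i.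
apply: lime_le.
  by apply: is_cvg_nneseries => n _ _; rewrite lee_fin.
near=> N; rewrite big_mkord sumEFin.
(* The first [N] atoms, one per piece, form the partition that reaches the partial sum. *)
apply: ereal_sup_ubound; exists N, (fun i : 'I_N => atoms E (pred1 (i : nat)) N); split.
- move=> i; split; first exact: bounded_borel_atoms.
  by move=> _ [n [_ _ En ->]].
- move=> i j _ _ [_ [[n [_ /eqP ni _ ->]] /atomsE[_ /eqP nj _]]].
  by apply/val_inj; rewrite /= -ni nj.
congr EFin; apply: eq_bigr => i _.
have [M0 etaE] := etac _ (bounded_borel_atoms E (pred1 (i : nat)) N).
rewrite (etaE (N + M0)%N) ?leq_addl// big_split_ord/=.
rewrite [X in _ + X]big1 ?addr0; last first.
  move=> j _; rewrite indicE memNset ?mulr0// => /atomsE[].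
  by rewrite ltnNge leq_addr.
rewrite (bigD1 i)//= [X in _ + X]big1 ?addr0; last first.
  move=> j ji; rewrite indicE memNset ?mulr0// => /atomsE[_ /eqP ji' _].
  by move/eqP: ji; apply; apply/val_inj; rewrite /= ji'.
rewrite -[RHS]/(cabs _) cabsM indC; congr (_ * _); rewrite !indicE.
suff -> : (x i \in atoms E (pred1 (i : nat)) N) = (x i \in E) by [].
apply/idP/idP => /set_mem xi; apply/mem_set; first by case/atomsE: xi.
by apply/atomsE; split=> /=.
Unshelve. all: by end_near. Qed.

End Atomic.

Section AtomicIntegral.
Variables (R : realType) (x : nat -> R).
Hypothesis x_gt0 : forall n, 0 < x n.
Hypothesis x_inj : injective x.
Local Notation mfun u := (measurable_fun (`]0, +oo[%classic : set R) u).

(** Recognizes the set function as a series of scaled Dirac measures, so that the integration lemmas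
    for measures apply. *)
Lemma weighted_diracE (mu : set R -> \bar R) (w : nat -> R) (w0 : forall n, 0 <= w n) :
  (forall E, mu E = (\sum_(n <oo) (w n * \1_E (x n))%:E)%E) ->
  mu = mseries (fun n => mscale (NngNum (w0 n)) (\d_(x n : measurableTypeR R))) 0.
Proof.
move=> muE; apply/funext => E; rewrite muE /mseries; apply: eq_eseriesr => n _.
by rewrite /= /mscale/= diracE EFinM indicE.
Qed.

Lemma integral_pos_series (mu : set R -> \bar R) (w : nat -> R) (u : R -> R) :
  (forall n, 0 <= w n) ->
  (forall E, mu E = (\sum_(n <oo) (w n * \1_E (x n))%:E)%E) ->
  mfun u -> (forall y, 0 < y -> 0 <= u y) ->
  integral_pos mu u = (\sum_(n <oo) (w n * u (x n))%:E)%E.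
Proof.
move=> w0 /(weighted_diracE w0) -> mu_ u0.
have u0E y : `]0, +oo[%classic y -> (0 <= (u y)%:E)%E.
  by rewrite /= in_itv/= andbT lee_fin; exact: u0.
have muE' : mfun (fun y => (u y)%:E).
  exact/measurable_EFinP.
have {muE'} muE' : measurable_fun (`]0%R, +oo[%classic : set (measurableTypeR R))
  (fun y : measurableTypeR R => (u y)%:E) := muE'.
rewrite /integral_pos ge0_integral_measure_series//.
apply: eq_eseriesr => n _; rewrite ge0_integral_mscale// integral_dirac//.
by rewrite diracE mem_set ?mul1e//= in_itv/= x_gt0.
Qed.

(** The positive and negative parts of [u] are integrated separately. The bound [B] makes both
    integrals finite, so [fine] returns their true value and not its default. *)
Lemma integral_pos_cvg (mu : set R -> \bar R) (w : nat -> R) (u : R -> R) (B : R) :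
  (forall n, 0 <= w n) ->
  (forall E, mu E = (\sum_(n <oo) (w n * \1_E (x n))%:E)%E) ->
  mfun u -> (forall N, \sum_(n < N) w n * `|u (x n)| <= B) ->
  (fun N : nat => \sum_(n < N) w n * u (x n)) @ \oo --> fine (integral_pos mu u).
Proof.
move=> w0 muE mu_ wB.
pose up := fun y => Num.max (u y) 0; pose un := fun y => Num.max (- u y) 0.
have up0 y : 0 <= up y by rewrite /up le_max lexx orbT.
have un0 y : 0 <= un y by rewrite /un le_max lexx orbT.
have upn y : up y - un y = u y.
  by rewrite /up /un; case: (leP (u y) 0); case: (leP (- u y) 0); lra.
have upu y : up y <= `|u y| by rewrite /up ge_max ler_norm normr_ge0.
have unu y : un y <= `|u y| by rewrite /un ge_max -normrN ler_norm normr_ge0.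
have mup : mfun up by exact: measurable_maxr.
have mun : mfun un by apply: measurable_maxr => //; exact: measurableT_comp.
have bound v : (forall y, v y <= `|u y|) -> forall N, \sum_(n < N) w n * v (x n) <= B.
  by move=> vu N; apply: le_trans (wB N); apply: ler_sum => n _; rewrite ler_wpM2l.
have [fp cp] := cvg_nneseries_fine (fun n => mulr_ge0 (w0 n) (up0 (x n))) (bound _ upu).
have [fn cn] := cvg_nneseries_fine (fun n => mulr_ge0 (w0 n) (un0 (x n))) (bound _ unu).
have -> : integral_pos mu u = (integral_pos mu up - integral_pos mu un)%E.
  rewrite (weighted_diracE w0 muE) /integral_pos integralE; congr (_ - _)%E; apply: eq_integral => y _.
  - by rewrite funeposE /up EFin_max.
  - by rewrite funenegE /un EFin_max.
rewrite !(integral_pos_series w0 muE)// fineB//.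
rewrite (_ : (fun _ => _) = (fun N : nat => \sum_(n < N) w n * up (x n)) -
  (fun N : nat => \sum_(n < N) w n * un (x n))); first exact: cvgB.
by apply/funext => N; rewrite fctE -sumrB; apply: eq_bigr => n _; rewrite -mulrBr upn.
Qed.

Lemma integral_signed_cvg (nu : set R -> R) (w : nat -> R) (u : R -> R) (B : R) :
  atomic x nu w -> mfun u ->
  (forall N, \sum_(n < N) `|w n| * `|u (x n)| <= B) ->
  (fun N : nat => \sum_(n < N) w n * u (x n)) @ \oo --> integral_signed nu u.
Proof.
move=> nuw mu wB; rewrite /integral_signed.
have nuwN : atomic x (fun A => - nu A) (fun n => - w n).
  move=> A /nuw[N0 nuE]; exists N0 => N /nuE ->; rewrite -sumrN.
  by apply: eq_bigr => n _; rewrite mulNr.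
have p0 (a : R) : 0 <= Num.max a 0 by rewrite le_max lexx orbT.
have bound (v : nat -> R) : (forall n, v n <= `|w n|) ->
    forall N, \sum_(n < N) v n * `|u (x n)| <= B.
  by move=> vw N; apply: le_trans (wB N); apply: ler_sum => n _; rewrite ler_wpM2r.
have cp := @integral_pos_cvg _ (fun n => Num.max (w n) 0) u B (fun n => p0 _)
  (fun E => pos_variation_atomic x_gt0 x_inj E nuw) mu.
have cn := @integral_pos_cvg _ (fun n => Num.max (- w n) 0) u B (fun n => p0 _)
  (fun E => pos_variation_atomic x_gt0 x_inj E nuwN) mu.
have wE n : w n = Num.max (w n) 0 - Num.max (- w n) 0.
  by case: (leP (w n) 0); case: (leP (- w n) 0); lra.
rewrite (_ : (fun _ => _) = (fun N : nat => \sum_(n < N) Num.max (w n) 0 * u (x n)) -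
  (fun N : nat => \sum_(n < N) Num.max (- w n) 0 * u (x n))); last first.
  apply/funext => N; rewrite fctE -sumrB; apply: eq_bigr => n _.
  by rewrite -mulrBl -wE.
have pw n : Num.max (w n) 0 <= `|w n| by rewrite ge_max ler_norm normr_ge0.
have nw n : Num.max (- w n) 0 <= `|w n|.
  by rewrite ge_max -normrN ler_norm normr_ge0.
exact: cvgB (cp (bound _ pw)) (cn (bound _ nw)).
Qed.

(** The complex integral is assembled from four real ones, pairing real and imaginary parts of the
    measure and of [f]. Each is dominated by the series of moduli. *)
Lemma has_sum_integral_complex (eta : set R -> R[i]) (c : nat -> R[i]) (f : R -> R[i]) :
  atomic x eta c ->
  mfun (fun y => complex.Re (f y)) -> mfun (fun y => complex.Im (f y)) ->
  abs_summable (fun n => c n * f (x n)) ->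
  has_sum (fun n => c n * f (x n)) (integral_complex eta f).
Proof.
move=> etac mRe mIm [B cB].
have ind (E : set R) y : (\1_E y : R[i]) = ((\1_E y : R)%:C)%C.
  by rewrite !indicE; case: (_ \in _).
have etaR : atomic x (fun A => complex.Re (eta A)) (fun n => complex.Re (c n)).
  move=> A /etac[N0 etaE]; exists N0 => N /etaE ->; rewrite Re_sum.
  by apply: eq_bigr => n _; rewrite ind; case: (c n) => a b /=; rewrite mulr0 subr0.
have etaI : atomic x (fun A => complex.Im (eta A)) (fun n => complex.Im (c n)).
  move=> A /etac[N0 etaE]; exists N0 => N /etaE ->; rewrite Im_sum.
  by apply: eq_bigr => n _; rewrite ind; case: (c n) => a b /=; rewrite mulr0 add0r.
have bound (v : nat -> R) (u : R -> R) : (forall n, `|v n| <= cabs (c n)) ->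
    (forall n, `|u (x n)| <= cabs (f (x n))) ->
    forall N, \sum_(n < N) `|v n| * `|u (x n)| <= B.
  move=> vc uf N; apply: le_trans (cB N); apply: ler_sum => n _.
  by rewrite cabsM ler_pM.
have RR := integral_signed_cvg etaR mRe (bound _ _ (fun n => Re_le_cabs _) (fun n => Re_le_cabs _)).
have RI := integral_signed_cvg etaR mIm (bound _ _ (fun n => Re_le_cabs _) (fun n => Im_le_cabs _)).
have IR := integral_signed_cvg etaI mRe (bound _ _ (fun n => Im_le_cabs _) (fun n => Re_le_cabs _)).
have II := integral_signed_cvg etaI mIm (bound _ _ (fun n => Im_le_cabs _) (fun n => Im_le_cabs _)).
apply: cvg_complex.
- rewrite (_ : complex.Re (integral_complex eta f) =
    integral_signed (fun A => complex.Re (eta A)) (fun y => complex.Re (f y)) -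
    integral_signed (fun A => complex.Im (eta A)) (fun y => complex.Im (f y))); last first.
    by rewrite /integral_complex /=; ring.
  rewrite (_ : (fun _ => _) = (fun N : nat => \sum_(n < N) complex.Re (c n) * complex.Re (f (x n))) -
    (fun N : nat => \sum_(n < N) complex.Im (c n) * complex.Im (f (x n)))).
    exact: cvgB RR II.
  apply/funext => N; rewrite Re_sum fctE /= -sumrB; apply: eq_bigr => n _.
  by case: (c n) (f (x n)) => a b [].
- rewrite (_ : complex.Im (integral_complex eta f) =
    integral_signed (fun A => complex.Im (eta A)) (fun y => complex.Re (f y)) +
    integral_signed (fun A => complex.Re (eta A)) (fun y => complex.Im (f y))); last first.
    by rewrite /integral_complex /=; ring.
  rewrite (_ : (fun _ => _) = (fun N : nat => \sum_(n < N) complex.Im (c n) * complex.Re (f (x n))) +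
    (fun N : nat => \sum_(n < N) complex.Re (c n) * complex.Im (f (x n)))).
    exact: cvgD IR RI.
  apply/funext => N; rewrite Im_sum fctE /= -big_split/=; apply: eq_bigr => n _.
  by case: (c n) (f (x n)) => a b [a' b'] /=; rewrite addrC.
Qed.

Lemma measurable_cpow (s : R[i]) :
  mfun (fun y => complex.Re (cpow y s)) /\ mfun (fun y => complex.Im (cpow y s)).
Proof.
have ml (a : R) : mfun (fun y => a * ln y).
  by apply: measurable_funM => //; apply: measurable_funTS; exact: measurable_ln.
split => /=; apply: measurable_funM.
- exact: (measurableT_comp (@measurable_expR R)).
- apply: (measurableT_comp (f := @cos R)) => //.
  by apply: continuous_measurable_fun; exact: continuous_cos.
- exact: (measurableT_comp (@measurable_expR R)).
- apply: (measurableT_comp (f := @sin R)) => //.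
  by apply: continuous_measurable_fun; exact: continuous_sin.
Qed.

Lemma cabs_cpow (y : R) (s : R[i]) : cabs (cpow y s) = expR (complex.Re s * ln y).
Proof.
rewrite cabsE /cpow/= !exprMn -mulrDr cos2Dsin2 mulr1 sqrtr_sqr.
by rewrite ger0_norm// expR_ge0.
Qed.

(** For a real exponent [powR] is the modulus of [cpow]; membership of [s] in the set defining the
    dimension becomes absolute summability. *)
Lemma variation_integrable (eta : set R -> R[i]) (c : nat -> R[i]) (s : R) :
  atomic x eta c ->
  (integral_pos (variation_measure eta) (fun y => powR y (- s)) < +oo)%E <->
  abs_summable (fun n => c n * cpow (x n) (- (s%:C)%C)).
Proof.
move=> etac; have w0 n : 0 <= cabs (c n) by exact: cabs_ge0.
rewrite (integral_pos_series w0 (fun E => variation_atomic x_gt0 x_inj E etac)); first last.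
- by move=> y _; exact: powR_ge0.
- by apply: measurable_funTS; exact: measurable_powR.
rewrite nneseries_fin; last by move=> n; rewrite mulr_ge0// powR_ge0.
have E N : \sum_(n < N) cabs (c n * cpow (x n) (- (s%:C)%C)) =
    \sum_(n < N) cabs (c n) * powR (x n) (- s).
  by apply: eq_bigr => n _; rewrite cabsM cabs_cpow /powR gt_eqF.
by split=> -[B cB]; exists B => N; rewrite ?E// -E.
Qed.

End AtomicIntegral.

(** * The complex exponential *)

Section ComplexExponential.
Local Open Scope complex_scope.
Variable R : realType.
Implicit Types (z w : R[i]) (t : R).

Definition cexp z : R[i] :=
  (expR (complex.Re z) * cos (complex.Im z)) +i* (expR (complex.Re z) * sin (complex.Im z)).

Lemma cpow_cexp (x : R) z : cpow x z = cexp (z * (ln x)%:C).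
Proof. by case: z => a b; rewrite /cpow /cexp /= !mulr0 subr0 add0r. Qed.

Lemma cexp0 : cexp 0 = 1.
Proof. by rewrite /cexp /= expR0 cos0 sin0 mulr1 mulr0. Qed.

Lemma cexpD z w : cexp (z + w) = cexp z * cexp w.
Proof.
case: z w => a b [c e]; rewrite /cexp /= expRD cosD sinD.
by apply/eqP; rewrite eq_complex /=; apply/andP; split; apply/eqP; ring.
Qed.

Lemma cexp_neq0 z : cexp z != 0.
Proof.
apply/negP => /eqP z0; have := cexpD z (- z).
by rewrite subrr cexp0 z0 mul0r => /eqP; rewrite oner_eq0.
Qed.

Lemma cexpMn z n : cexp (z *+ n) = cexp z ^+ n.
Proof. by elim: n => [|n IH]; rewrite ?mulr0n ?cexp0// mulrS cexpD IH exprS. Qed.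

Lemma cabs_cexp z : cabs (cexp z) = expR (complex.Re z).
Proof.
rewrite cabsE /cexp /= !exprMn -mulrDr cos2Dsin2 mulr1 sqrtr_sqr.
by rewrite ger0_norm// expR_ge0.
Qed.

Definition exp_partial n z : R[i] := \sum_(k < n) z ^+ k / k`!%:R.

Lemma ReZ (a : R) z : complex.Re (a%:C * z) = a * complex.Re z.
Proof. by case: z => b c /=; rewrite mul0r subr0. Qed.

Lemma ImZ (a : R) z : complex.Im (a%:C * z) = a * complex.Im z.
Proof. by case: z => b c /=; rewrite mul0r addr0. Qed.

(** Differentiation along the real ray through [z], in real and imaginary parts, so that the real
    mean value theorem can be used. *)
Lemma is_derive_cexp z t :
  is_derive t 1 (fun t : R => complex.Re (cexp (t%:C * z))) (complex.Re (z * cexp (t%:C * z))) /\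
  is_derive t 1 (fun t : R => complex.Im (cexp (t%:C * z))) (complex.Im (z * cexp (t%:C * z))).
Proof.
rewrite /cexp /=; split.
- under eq_fun do rewrite ReZ ImZ.
  rewrite ReZ ImZ; case: z => a b /=.
  apply: is_derive_eq; rewrite /GRing.scale /=; ring.
- under eq_fun do rewrite ReZ ImZ.
  rewrite ReZ ImZ; case: z => a b /=.
  apply: is_derive_eq; rewrite /GRing.scale /=; ring.
Qed.

Lemma is_derive_exp_partial z n t :
  is_derive t 1 (fun t : R => complex.Re (exp_partial n.+1 (t%:C * z)))
    (complex.Re (z * exp_partial n (t%:C * z))) /\
  is_derive t 1 (fun t : R => complex.Im (exp_partial n.+1 (t%:C * z)))
    (complex.Im (z * exp_partial n (t%:C * z))).
Proof.
have powE m (u : R) : (u%:C * z) ^+ m / m`!%:R = (u ^+ m)%:C * (z ^+ m / m`!%:R).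
  by rewrite exprMn rmorphXn mulrA.
have stepE m : z * (t%:C * z) ^+ m / m`!%:R =
    (m.+1%:R * t ^+ m)%:C * (z ^+ m.+1 / m.+1`!%:R).
  rewrite exprMn rmorphM rmorphXn /= rmorph_nat factS natrM exprS.
  have m0 : m.+1%:R != 0 :> R[i] by rewrite pnatr_eq0.
  have mf0 : m`!%:R != 0 :> R[i] by rewrite pnatr_eq0 -lt0n fact_gt0.
  move: (m.+1%:R : R[i]) (m`!%:R : R[i]) m0 mf0 => A B A0 B0.
  by field; rewrite A0 B0.
elim: n => [|n [IHr IHi]].
  rewrite /exp_partial big_ord0 mulr0.
  under eq_fun do rewrite big_ord_recl big_ord0 expr0 fact0 divr1 addr0.
  under [X in _ /\ is_derive _ _ X _]eq_fun do rewrite big_ord_recl big_ord0 expr0 fact0 divr1 addr0.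
  by split; exact: is_derive_cst.
have E u : exp_partial n.+2 (u%:C * z) =
    exp_partial n.+1 (u%:C * z) + (u ^+ n.+1)%:C * (z ^+ n.+1 / n.+1`!%:R).
  by rewrite /exp_partial big_ord_recr /= powE.
have E' : z * exp_partial n.+1 (t%:C * z) = z * exp_partial n (t%:C * z) +
    (n.+1%:R * t ^+ n)%:C * (z ^+ n.+1 / n.+1`!%:R).
  by rewrite /exp_partial big_ord_recr /= mulrDr mulrA stepE.
have mono (c : R) : is_derive t 1 (fun u : R => u ^+ n.+1 * c) (n.+1%:R * t ^+ n * c).
  have h := @is_deriveX _ R id n.+1 t 1 1 (is_derive_id _ _).
  have h' := @is_deriveM _ R _ (cst c) t 1 _ _ h (is_derive_cst _ _ _).
  rewrite (_ : (fun _ => _) = (@id R) ^+ n.+1 * cst c); last by apply/funext => u; rewrite !fctE.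
  apply: (@is_derive_eq _ _ _ _ _ _ _ _ h').
  by rewrite /GRing.scale /=; ring.
split.
- under eq_fun do rewrite E ReD ReZ.
  by rewrite E' ReD ReZ; exact: (@is_deriveD _ R R _ _ t 1 _ _ IHr (mono _)).
- under eq_fun do rewrite E ImD ImZ.
  by rewrite E' ImD ImZ; exact: (@is_deriveD _ R R _ _ t 1 _ _ IHi (mono _)).
Qed.

(** The mean value theorem fails for complex values; applying it to the real and imaginary parts
    separately costs the factor 2. *)
Lemma complex_mvt (f df : R -> R[i]) (M : R) :
  (forall t, is_derive t 1 (fun t => complex.Re (f t)) (complex.Re (df t))) ->
  (forall t, is_derive t 1 (fun t => complex.Im (f t)) (complex.Im (df t))) ->
  (forall t, 0 <= t <= 1 -> cabs (df t) <= M) ->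
  cabs (f 1 - f 0) <= M + M.
Proof.
move=> dRe dIm dfM.
have mvt (g dg : R -> R) : (forall t, is_derive t 1 g (dg t)) ->
    (forall t, `|dg t| <= cabs (df t)) -> `|g 1 - g 0| <= M.
  move=> dg_ gM; have gc : {within `[0, 1], continuous g}.
    by apply: derivable_within_continuous => t _; exact: ex_derive.
  have [c cI ->] := @MVT_segment R g dg 0 1 ler01 (fun t _ => dg_ t) gc.
  by rewrite subr0 mulr1 (le_trans (gM c))// dfM.
apply: le_trans (cabs_le_ReIm _) _; rewrite ReB ImB lerD//.
- by apply: (mvt (fun t => complex.Re (f t)) _ dRe) => t; exact: Re_le_cabs.
- by apply: (mvt (fun t => complex.Im (f t)) _ dIm) => t; exact: Im_le_cabs.
Qed.

(* Along [t |-> t z] the remainder of order [n+1] has derivative [z] times the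
   remainder of order [n]. *)
Lemma cexp_taylor n : exists2 M : R, 0 <= M &
  forall z, cabs z <= 1 -> cabs (cexp z - exp_partial n z) <= M * cabs z ^+ n.
Proof.
elim: n => [|n [M M0 IH]].
  exists (expR 1) => [|z z1]; first exact: expR_ge0.
  rewrite /exp_partial big_ord0 subr0 cabs_cexp expr0 mulr1 ler_expR.
  exact: le_trans (le_trans (ler_norm _) (Re_le_cabs _)) z1.
exists (M + M) => [|z z1]; first by rewrite addr_ge0.
pose f t := cexp (t%:C * z) - exp_partial n.+1 (t%:C * z).
pose df t := z * (cexp (t%:C * z) - exp_partial n (t%:C * z)).
have f1 : f 1 = cexp z - exp_partial n.+1 z by rewrite /f mul1r.
have f0 : f 0 = 0.
  rewrite /f mul0r cexp0 /exp_partial big_ord_recl expr0 fact0 divr1 big1 ?addr0 ?subrr//.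
  by move=> i _; rewrite lift0 expr0n mul0r.
rewrite -f1 -[f 1]subr0 -f0 mulrDl; apply: (@complex_mvt _ df).
- move=> t; rewrite /f /df.
  under eq_fun do rewrite ReB.
  rewrite mulrBr ReB.
  have := (is_derive_cexp z t).1; have := (is_derive_exp_partial z n t).1.
  by move=> h1 h2; exact: is_deriveB.
- move=> t; rewrite /f /df.
  under eq_fun do rewrite ImB.
  rewrite mulrBr ImB.
  have := (is_derive_cexp z t).2; have := (is_derive_exp_partial z n t).2.
  by move=> h1 h2; exact: is_deriveB.
- move=> t /andP[t0 t1]; rewrite /df cabsM exprS mulrCA ler_wpM2l ?cabs_ge0//.
  have tz : cabs (t%:C * z) <= cabs z.
    by rewrite cabsM cabs_real ger0_norm// ler_piMl ?cabs_ge0.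
  apply: le_trans (IH _ (le_trans tz z1)) _.
  by rewrite ler_wpM2l// lerXn2r ?nnegrE ?cabs_ge0.
Qed.

End ComplexExponential.

(** * Entire functions with Taylor expansions *)

Section ComplexDerivatives.
Local Open Scope complex_scope.
Variable R : realType.
Local Notation C := (R[i]^o).
Implicit Types (z w d : R[i]) (f g : R[i] -> R[i]).

(** A positive element of [R[i]] is real, so the balls of the topology on [C] are the balls of
    [cabs]. *)
Lemma near_cabsP z (P : R[i] -> Prop) : (\forall w \near (z : C), P w) <->
  exists2 e : R, 0 < e & forall w, cabs (w - z) < e -> P w.
Proof.
split=> [/nbhs_ballP[[a b] /= /[!ltcE] /= /andP[/eqP -> a0] zP]|[e e0 eP]].
  exists a => // w wz; apply: zP; rewrite /ball/= /ball_ -opprB normrN normc_cabs.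
  by rewrite ltcE /= eqxx.
apply/nbhs_ballP; exists e%:C => /=; first by rewrite ltcR.
move=> w; rewrite /ball/= /ball_ -opprB normrN normc_cabs ltcR; exact: eP.
Qed.

Lemma dnear_cabsP z (P : R[i] -> Prop) : (\forall w \near ((z : C)^'), P w) <->
  exists2 e : R, 0 < e & forall w, w != z -> cabs (w - z) < e -> P w.
Proof.
split.
  move=> /(near_cabsP z (fun w => w != z -> P w))[e e0 eP].
  by exists e => // w wz we; exact: eP.
move=> [e e0 eP]; apply/(near_cabsP z (fun w => w != z -> P w)).
by exists e => // w we wz; exact: eP.
Qed.

Lemma cderivableD f g z : derivable (f : C -> C) (z : C) 1 ->
  derivable (g : C -> C) (z : C) 1 ->
  derivable ((fun w => f w + g w) : C -> C) (z : C) 1.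
Proof. by move=> df dg; exact: (@derivableD _ C C _ _ _ _ df dg). Qed.

Lemma cderivableM f g z : derivable (f : C -> C) (z : C) 1 ->
  derivable (g : C -> C) (z : C) 1 ->
  derivable ((fun w => f w * g w) : C -> C) (z : C) 1.
Proof. by move=> df dg; exact: (@derivableM _ C _ _ _ _ df dg). Qed.

Lemma cderivableX f z n : derivable (f : C -> C) (z : C) 1 ->
  derivable ((fun w => f w ^+ n) : C -> C) (z : C) 1.
Proof.
move=> df; elim: n => [|n IH]; first exact: derivable_cst.
rewrite (_ : (fun _ => _) = fun w => f w * f w ^+ n); first exact: cderivableM.
by apply/funext => w; rewrite exprS.
Qed.

Lemma cderivable_div f g z : derivable (f : C -> C) (z : C) 1 ->
  derivable (g : C -> C) (z : C) 1 -> g z != 0 ->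
  derivable ((fun w => f w / g w) : C -> C) (z : C) 1.
Proof.
move=> df dg gz.
have dV : derivable ((fun w => (g w)^-1) : C -> C) (z : C) 1.
  exact: (@derivableV _ C g z 1 gz dg).
exact: cderivableM df dV.
Qed.

Lemma derivable_quadratic f z d (M e : R) : 0 < e ->
  (forall w, cabs w < e -> cabs (f (z + w) - f z - d * w) <= M * cabs w ^+ 2) ->
  derivable (f : C -> C) (z : C) 1.
Proof.
move=> e0 fM; apply/cvg_ex; exists (d : C); apply/cvgrPdist_lt => /= a.
rewrite ltcE /= => /andP[/eqP a_im a0].
have M1 : 0 < `|M| + 1 by rewrite ltr_wpDl.
(* The difference quotient misses [d] by at most [M * cabs w]. The summand 1 keeps the denominator
   positive. *)
apply/dnear_cabsP; exists (Num.min e (complex.Re a / (`|M| + 1))).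
  by rewrite lt_min e0 divr_gt0.
move=> w w0; rewrite subr0 lt_min => /andP[we wa].
have aE : a = (complex.Re a)%:C by rewrite [LHS]complexE a_im mulr0 addr0.
rewrite aE normc_cabs ltcR /GRing.scale /= mulr1 -cabsN opprB.
have -> : w^-1 * (f (w + z) - f z) - d = w^-1 * (f (z + w) - f z - d * w).
  by rewrite (addrC w z); field.
have cw : 0 < cabs w by rewrite lt_neqAle cabs_ge0 eq_sym cabs_eq0 w0.
rewrite cabsM cabsV ltr_pdivrMl//.
apply: le_lt_trans (fM _ we) _; rewrite expr2 mulrCA ltr_pM2l//.
apply: (@le_lt_trans _ _ (`|M| * cabs w)).
  by rewrite ler_wpM2r ?cabs_ge0 ?ler_norm.
by rewrite ltr_pdivlMr// in wa; apply: le_lt_trans wa; nra.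
Qed.

Lemma derivable_continuous f z : derivable (f : C -> C) (z : C) 1 ->
  {for (z : C), continuous (f : C -> C)}.
Proof. by move=> /derivable1_diffP/differentiable_continuous. Qed.

Lemma derivable_near0 f z : derivable (f : C -> C) (z : C) 1 -> f z != 0 ->
  \forall w \near (z : C), f w != 0.
Proof.
move=> /derivable_continuous/cvgrPdist_lt fz fz0; have nf0 : 0 < `|f z| by rewrite normr_gt0.
have := fz _ nf0; apply: filterS => w; apply: contraTneq => ->.
by rewrite subr0 ltxx.
Qed.

Lemma derivable_near_eq f g z : derivable (f : C -> C) (z : C) 1 ->
  (\forall w \near (z : C), f w = g w) -> derivable (g : C -> C) (z : C) 1.
Proof.
by move=> df fg; move: df; apply: (@near_eq_derivable _ C C).
Qed.

End ComplexDerivatives.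

Section TaylorClass.
Local Open Scope complex_scope.
Variable R : realType.
Local Notation C := (R[i]^o).
Implicit Types (z w d s : R[i]) (f g : R[i] -> R[i]) (n : nat).

Definition bigOpow n f := exists M e : R, [/\ 0 <= M, 0 < e &
  forall w, cabs w < e -> cabs (f w) <= M * cabs w ^+ n].

Lemma bigOpow_le m n f : (m <= n)%N -> bigOpow n f -> bigOpow m f.
Proof.
move=> mn [M [e [M0 e0 fM]]]; exists M, (Num.min e 1); split=> //.
  by rewrite lt_min e0 ltr01.
move=> w; rewrite lt_min => /andP[we w1]; apply: le_trans (fM _ we) _.
by rewrite ler_wpM2l// ler_wiXn2l// ?cabs_ge0// ltW.
Qed.

Lemma bigOpowD n f g : bigOpow n f -> bigOpow n g -> bigOpow n (fun w => f w + g w).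
Proof.
move=> [M [e [M0 e0 fM]]] [M' [e' [M'0 e'0 gM]]].
exists (M + M'), (Num.min e e'); split; [exact: addr_ge0|by rewrite lt_min e0|].
move=> w; rewrite lt_min => /andP[we we']; apply: le_trans (cabsD _ _) _.
by rewrite mulrDl lerD ?fM ?gM.
Qed.

Lemma bigOpowM m n f g : bigOpow m f -> bigOpow n g -> bigOpow (m + n) (fun w => f w * g w).
Proof.
move=> [M [e [M0 e0 fM]]] [M' [e' [M'0 e'0 gM]]].
exists (M * M'), (Num.min e e'); split; [exact: mulr_ge0|by rewrite lt_min e0|].
move=> w; rewrite lt_min => /andP[we we']; rewrite cabsM exprD mulrACA.
by rewrite ler_pM ?cabs_ge0 ?fM ?gM.
Qed.

Lemma bigOpow_eq n f g : f =1 g -> bigOpow n f -> bigOpow n g.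
Proof. by move=> /funext ->. Qed.

Lemma bigOpow_cst c : bigOpow 0 (fun _ => c).
Proof.
by exists (cabs c), 1; split=> //; [exact: cabs_ge0|move=> w _; rewrite expr0 mulr1].
Qed.

Lemma bigOpow_id : bigOpow 1 id.
Proof. by exists 1, 1; split=> // w _; rewrite expr1 mul1r. Qed.

Lemma bigOpow_exp n : bigOpow n (fun w => w ^+ n).
Proof. by exists 1, 1; split=> // w _; rewrite cabsX mul1r. Qed.

Lemma bigOpow_horner (p : {poly R[i]}) : bigOpow 0 (fun w => p.[w]).
Proof.
elim/poly_ind: p => [|p c IH].
  by apply: bigOpow_eq (bigOpow_cst 0) => w; rewrite horner0.
apply: (@bigOpow_eq _ (fun w => p.[w] * w + c)) => [w|].
  by rewrite hornerMXaddC.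
apply: bigOpowD; last exact: bigOpow_cst.
exact: (bigOpowM IH (bigOpow_le (leq0n 1) bigOpow_id)).
Qed.

(** The part of [p] of degree at least 2 is absorbed into the remainder, which leaves an affine
    approximation with quadratic error. *)
Lemma derivable_expansion f s (p : {poly R[i]}) :
  bigOpow 2 (fun w => f (s + w) - p.[w]) -> p`_0 = f s ->
  derivable (f : C -> C) (s : C) 1.
Proof.
move=> fp p0.
have pE w : p.[w] = (drop_poly 2 p).[w] * w ^+ 2 + (p`_1 * w + f s).
  rewrite -[p in LHS](poly_take_drop 2) hornerD hornerM hornerXn addrC.
  congr (_ + _); rewrite horner_poly !big_ord_recl big_ord0 /= -p0.
  by rewrite expr0 mulr1 addr0 addrC.
have h := bigOpowM (bigOpow_horner (drop_poly 2 p)) (bigOpow_exp 2).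
rewrite add0n in h; have [M [e [_ e0 fM]]] := bigOpowD fp h.
apply: (@derivable_quadratic _ _ _ p`_1 M e) => // w we.
apply: le_trans (fM _ we); rewrite le_eqVlt; apply/orP; left; apply/eqP.
by congr cabs; rewrite pE; ring.
Qed.

(** The polynomial may depend on the order [n]; no convergence of a Taylor series is claimed. *)
Definition taylor f s := forall n, exists p : {poly R[i]},
  bigOpow n (fun w => f (s + w) - p.[w]).

(* The expansions take the place of Cauchy's formula when zeros are divided out. *)
Definition expandable f := entire f /\ forall s, taylor f s.

Lemma expandable_cst c : expandable (fun _ => c).
Proof.
split=> [z|s n]; first exact: derivable_cst.
exists c%:P; apply: (@bigOpow_eq _ (fun _ => 0 * 0 ^+ n)) => [w|].
  by rewrite hornerC subrr mul0r.
by exists 0, 1; split=> // w _; rewrite !mul0r cabs0.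
Qed.

Lemma expandableD f g : expandable f -> expandable g ->
  expandable (fun s => f s + g s).
Proof.
move=> [fe ft] [ge gt]; split=> [z|s n].
  exact: cderivableD (fe z) (ge z).
have [p fp] := ft s n; have [q gq] := gt s n; exists (p + q).
by apply: bigOpow_eq (bigOpowD fp gq) => w; rewrite hornerD; ring.
Qed.

(** Uses fg - pq = (f - p)g + p(g - q), where g is bounded near the point because it has an
    expansion. *)
Lemma expandableM f g : expandable f -> expandable g ->
  expandable (fun s => f s * g s).
Proof.
move=> [fe ft] [ge gt]; split=> [z|s n].
  exact: cderivableM (fe z) (ge z).
have [p fp] := ft s n; have [q gq] := gt s n; exists (p * q).
have gO : bigOpow 0 (fun w => g (s + w)).
  apply: bigOpow_eq (bigOpowD (bigOpow_le (leq0n n) gq) (bigOpow_horner q)) => w.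
  by rewrite subrK.
have h1 := bigOpowM fp gO; have h2 := bigOpowM (bigOpow_horner p) gq.
rewrite addn0 in h1; rewrite add0n in h2.
by apply: bigOpow_eq (bigOpowD h1 h2) => w; rewrite hornerM; ring.
Qed.

Lemma expandable_horner (p : {poly R[i]}) f : expandable f ->
  expandable (fun s => p.[f s]).
Proof.
move=> fE; elim/poly_ind: p => [|p c IH].
  rewrite (_ : (fun _ => _) = fun=> 0); first exact: expandable_cst.
  by apply/funext => s; rewrite horner0.
rewrite (_ : (fun _ => _) = fun s => p.[f s] * f s + c).
  by apply: expandableD (expandable_cst c); exact: expandableM.
by apply/funext => s; rewrite hornerMXaddC.
Qed.

Lemma expandable_sum (I : Type) (r : seq I) (F : I -> R[i] -> R[i]) :
  (forall i, expandable (F i)) -> expandable (fun s => \sum_(i <- r) F i s).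
Proof.
move=> FE; elim: r => [|i r IH].
  rewrite (_ : (fun _ => _) = fun=> 0); first exact: expandable_cst.
  by apply/funext => s; rewrite big_nil.
rewrite (_ : (fun _ => _) = fun s => F i s + \sum_(j <- r) F j s).
  exact: expandableD.
by apply/funext => s; rewrite big_cons.
Qed.

Lemma cexp_expansion (l : R) s n : exists p : {poly R[i]},
  bigOpow n (fun w => cexp ((s + w) * l%:C) - p.[w]) /\
  forall k, (k < n)%N -> p`_k = cexp (s * l%:C) * l%:C ^+ k / k`!%:R.
Proof.
have [M M0 cM] := @cexp_taylor R n.
exists (\poly_(k < n) (cexp (s * l%:C) * l%:C ^+ k / k`!%:R)); split; last first.
  by move=> k kn; rewrite coef_poly kn.
(* This radius keeps [w * l] in the unit disc, where the remainder estimate for the exponential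
   holds. *)
exists (cabs (cexp (s * l%:C)) * (M * `|l| ^+ n)), (`|l| + 1)^-1.
have l1 : 0 < `|l| + 1 by rewrite ltr_wpDl.
split; [by rewrite !mulr_ge0 ?cabs_ge0 ?exprn_ge0|by rewrite invr_gt0|].
move=> w wl.
have wl1 : cabs (w * l%:C) <= 1.
  rewrite cabsM cabs_real; have := normr_ge0 l; have := cabs_ge0 w.
  have : cabs w * (`|l| + 1) < 1 by rewrite -ltr_pdivlMr// mul1r.
  by nra.
have -> : cexp ((s + w) * l%:C) -
    (\poly_(k < n) (cexp (s * l%:C) * l%:C ^+ k / k`!%:R)).[w] =
    cexp (s * l%:C) * (cexp (w * l%:C) - exp_partial n (w * l%:C)).
  rewrite mulrDl cexpD mulrBr horner_poly; congr (_ - _).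
  rewrite /exp_partial mulr_sumr; apply: eq_bigr => k _.
  by rewrite exprMn; ring.
rewrite cabsM -!mulrA ler_wpM2l ?cabs_ge0//.
apply: le_trans (cM _ wl1) _; rewrite cabsM cabs_real exprMn.
by rewrite [X in _ <= M * X]mulrC.
Qed.

Lemma derivable_cexp (l : R) z :
  derivable ((fun s => cexp (s * l%:C)) : C -> C) (z : C) 1.
Proof.
have [p [pO pE]] := cexp_expansion l z 2.
by apply: (derivable_expansion pO); rewrite pE// expr0 mulr1 fact0 divr1.
Qed.

Lemma expandable_cexp (l : R) : expandable (fun s => cexp (s * l%:C)).
Proof.
split=> [z|s n]; first exact: derivable_cexp.
by have [p [h _]] := cexp_expansion l s n; exists p.
Qed.

(** Dividing an expansion of order [k.+2] by w^k leaves one of order 2 for the quotient, which is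
    what [derivable_expansion] needs at [s0]. The value filled in there is the coefficient of index
    [k]. *)
Lemma factor_order f s0 k (p : {poly R[i]}) : entire f ->
  bigOpow k.+2 (fun w => f (s0 + w) - p.[w]) -> (forall j, (j < k)%N -> p`_j = 0) ->
  exists f1 : R[i] -> R[i],
    [/\ forall s, derivable (f1 : C -> C) (s : C) 1,
        forall s, f s = (s - s0) ^+ k * f1 s & f1 s0 = p`_k].
Proof.
move=> fe fp pk.
pose f1 s := if s == s0 then p`_k else f s / (s - s0) ^+ k.
exists f1; split; last by rewrite /f1 eqxx.
- move=> s; have [->|ss0] := eqVneq s s0; last first.
    apply: (@derivable_near_eq _ (fun s => f s * ((s - s0) ^+ k)^-1)).
      apply: (cderivable_div (fe s)); last by rewrite expf_neq0// subr_eq0.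
      apply: cderivableX; apply: cderivableD; first exact: derivable_id.
      exact: derivable_cst.
    apply/near_cabsP; exists (cabs (s - s0)).
      by rewrite lt_neqAle cabs_ge0 eq_sym cabs_eq0 subr_eq0 ss0.
    move=> w ws; rewrite /f1 ifF//; apply/negbTE; apply: contraTneq ws => ->.
    by rewrite -[cabs (s0 - s)]cabsN opprB ltxx.
  pose q := drop_poly k p.
  have pq w : p.[w] = q.[w] * w ^+ k.
    rewrite -[p in LHS](poly_take_drop k) (_ : take_poly k p = 0) ?add0r ?hornerE ?hornerXn//.
    by apply/polyP => j; rewrite coef_take_poly coef0; case: ltnP => // /pk.
  have q0 : q`_0 = p`_k by rewrite coef_drop_poly.
  have f1q : bigOpow 2 (fun w => f1 (s0 + w) - q.[w]).
    have [M [e [M0 e0 fM]]] := fp; exists M, e; split=> // w we.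
    have [->|w0] := eqVneq w 0.
      by rewrite addr0 /f1 eqxx horner_coef0 q0 subrr cabs0 mulr_ge0 ?exprn_ge0 ?cabs_ge0.
    have cw : 0 < cabs w by rewrite lt_neqAle cabs_ge0 eq_sym cabs_eq0 w0.
    rewrite /f1 ifF; last by rewrite -subr_eq0 addrC addKr (negbTE w0).
    have -> : f (s0 + w) / (s0 + w - s0) ^+ k - q.[w] = (f (s0 + w) - p.[w]) / w ^+ k.
      rewrite (addrC s0 w) addrK pq mulrBl mulfK// expf_neq0//.
    rewrite cabsM cabsV cabsX ler_pdivrMr ?exprn_gt0// -mulrA -exprD add2n.
    exact: fM.
  by apply: (derivable_expansion f1q); rewrite q0 /f1 eqxx.
- move=> s; rewrite /f1; have [->|ss0] := eqVneq s s0; last first.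
    by rewrite mulrC divfK// expf_neq0// subr_eq0.
  (* The estimate at w = 0 gives f(s0) = p(0). This settles s = s0: for k = 0 the power is 1,
     otherwise both sides vanish. *)
  have [M [e [M0 e0 fM]]] := fp.
  have := fM 0; rewrite cabs0 => /(_ e0); rewrite expr0n mulr0 addr0 => h.
  have /eqP : cabs (f s0 - p.[0]) = 0 by apply/eqP; rewrite eq_le h cabs_ge0.
  rewrite cabs_eq0 subr_eq0 => /eqP ->; rewrite subrr expr0n horner_coef0.
  by case: k pk {fp fM f1} => [|k] pk; rewrite ?mul1r// mul0r pk.
Qed.

(** [k] is the order of vanishing capped at [m], so a function vanishing to infinite order causes no
    trouble. *)
Lemma factor_upto f s0 m : expandable f -> exists k (f1 : R[i] -> R[i]),
  [/\ (k <= m)%N, forall s, derivable (f1 : C -> C) (s : C) 1,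
      forall s, f s = (s - s0) ^+ k * f1 s & (k < m)%N -> f1 s0 != 0].
Proof.
move=> [fe ft]; have [p fp] := ft s0 m.+2.
(* The disjunct [k == m] is the cap and guarantees that the minimum exists. *)
have exk : exists k, (k == m) || (p`_k != 0) by exists m; rewrite eqxx.
case: (ex_minnP exk) => k kP kmin.
have km : (k <= m)%N by apply: kmin; rewrite eqxx.
have pk j : (j < k)%N -> p`_j = 0.
  move=> jk; apply/eqP; apply: contraTT jk => pj; rewrite -leqNgt.
  by apply: kmin; rewrite pj orbT.
have fpk : bigOpow k.+2 (fun w => f (s0 + w) - p.[w]) by apply: bigOpow_le fp.
have [f1 [f1d f1E f10]] := factor_order fe fpk pk.
exists k, f1; split=> // km'; rewrite f10.
by move: kP; rewrite (ltn_eqF km').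
Qed.

End TaylorClass.

(** * Quotients of entire functions *)

Section MeromorphicQuotient.
Local Open Scope complex_scope.
Variable R : realType.
Local Notation C := (R[i]^o).
Implicit Types (z w s : R[i]) (f g h q : R[i] -> R[i]).

(* At a zero of [q] the limit fills in a removable singularity; it is a junk
   value at a pole. *)
Definition mero_quot h q s : R[i] :=
  if q s == 0 then lim (((fun w => h w / q w) : C -> C) @ ((s : C)^')) else h s / q s.

(** The function e^(sl) - e^(s0 l) has a simple zero at [s0], its derivative there being l e^(s0 l),
    which is nonzero. The order of the composite at [s0] is therefore the multiplicity [m] of [p] at
    [z0], possibly 0. *)
Lemma horner_cexp_factor (p : {poly R[i]}) (l : R) s0 : p != 0 -> l != 0 ->
  exists m (q : R[i] -> R[i]),
    [/\ forall s, derivable (q : C -> C) (s : C) 1,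
        forall s, p.[cexp (s * l%:C)] = (s - s0) ^+ m * q s & q s0 != 0].
Proof.
move=> p0 l0; pose z0 := cexp (s0 * l%:C).
have [m [p1 p1z0 pE]] := multiplicity_XsubC p z0.
have [t [tO tE]] := cexp_expansion l s0 3.
have eE : expandable (fun s => cexp (s * l%:C) + - z0).
  exact: expandableD (expandable_cexp l) (expandable_cst _).
have tO' : bigOpow 3 (fun w => cexp ((s0 + w) * l%:C) + - z0 - (t - z0%:P).[w]).
  by apply: bigOpow_eq tO => w; rewrite hornerD hornerN hornerC; ring.
have t0 j : (j < 1)%N -> (t - z0%:P)`_j = 0.
  by case: j => // _; rewrite coefB coefC tE// expr0 mulr1 fact0 divr1 subrr.
have [e1 [e1d e1E e10]] := factor_order eE.1 tO' t0.
exists m, (fun s => p1.[cexp (s * l%:C)] * e1 s ^+ m); split.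
- move=> s; have [pd _] := expandable_horner p1 (expandable_cexp l).
  exact: cderivableM (pd s) (@cderivableX _ _ _ m (e1d s)).
- move=> s; rewrite pE hornerM horner_exp hornerXsubC -[_ - z0]/(_ + - z0) e1E expr1.
  by rewrite exprMn; ring.
- rewrite mulf_neq0 ?expf_neq0//; first by move: p1z0; rewrite p0.
  rewrite e10 coefB coefC subr0 tE// expr1 divr1 mulf_neq0 ?cexp_neq0//.
  by apply: contra l0 => /eqP[->].
Qed.

Section Quotient.
Local Open Scope complex_scope.
Variables (h q : R[i] -> R[i]).
Hypothesis h_exp : expandable h.
Hypothesis q_der : entire q.
Hypothesis q_factor : forall s0, exists m (q1 : R[i] -> R[i]),
  [/\ forall s, derivable (q1 : C -> C) (s : C) 1,
      forall s, q s = (s - s0) ^+ m * q1 s & q1 s0 != 0].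

Local Notation F := (mero_quot h q).

Lemma mero_quot_derivable s : q s != 0 -> derivable (F : C -> C) (s : C) 1.
Proof.
move=> qs; have := cderivable_div (h_exp.1 s) (@q_der s) qs.
move=> /derivable_near_eq; apply.
have := derivable_near0 (@q_der s) qs; apply: filterS => w qw.
by rewrite /mero_quot (negbTE qw).
Qed.

(** Near such a point the function is the plain quotient, hence continuous and bounded, which
    excludes a pole. *)
Lemma mero_quot_regular s : q s != 0 -> holomorphic_at F s /\ ~ pole F s.
Proof.
move=> qs; split.
  have := derivable_near0 (@q_der s) qs; apply: filterS => w.
  exact: mero_quot_derivable.
move=> [_ /cvgryPge/(_ (cabs (F s) + 1)) Fpole].
have /derivable_continuous/cvgrPdist_lt/(_ 1 ltr01) Fc := mero_quot_derivable qs.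
have [w [Fw1 Fw2]] := @filter_ex _ ((s : C)^') _ _ (filterI Fpole (nbhs_dnbhs Fc)).
have {}Fw1 : cabs (F s) + 1 <= cabs (F w) := Fw1.
move: Fw2; rewrite /mkset normc_cabs -(rmorph1 (real_complex R)) ltcR => Fw2.
have : cabs (F w) <= cabs (F s) + cabs (F s - F w).
  by rewrite -[cabs (F s - F w)]cabsN opprB; have := cabsD (F w - F s) (F s); rewrite subrK addrC.
by move: Fw1 Fw2; lra.
Qed.

(** Compares the order [m] of [q] with the order [k] of [h] capped at [m]: a pole if k < m, a
    removable singularity if k = m. The last claim, applied to the constant 1, makes every zero of
    [q] a pole of the reciprocal. *)
Lemma mero_quot_singular s0 : q s0 = 0 ->
  (holomorphic_at F s0 \/ pole F s0) /\ (h s0 != 0 -> pole F s0).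
Proof.
move=> qs0; have [m [q1 [q1d q1E q10]]] := q_factor s0.
have m_gt0 : (0 < m)%N.
  case: m q1E => // /(_ s0); rewrite qs0 expr0 mul1r => /esym/eqP.
  by rewrite (negbTE q10).
have [k [h1 [km h1d h1E h10]]] := factor_upto s0 m h_exp.
pose G s := h1 s / q1 s.
have Gd s : q1 s != 0 -> derivable (G : C -> C) (s : C) 1.
  by move=> q1s; exact: cderivable_div (h1d s) (q1d s) q1s.
have q1near := derivable_near0 (q1d s0) q10.
have FE w : w != s0 -> q1 w != 0 -> F w = G w / (w - s0) ^+ (m - k).
  move=> ws0 q1w; have ws : w - s0 != 0 by rewrite subr_eq0.
  rewrite /mero_quot q1E mulf_eq0 (negbTE q1w) orbF expf_eq0 (negbTE ws) andbF.
  rewrite h1E -{1}(subnK km) exprD /G.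
  by field; rewrite q1w !expf_neq0.
have Fd : \forall w \near ((s0 : C)^'), derivable (F : C -> C) (w : C) 1.
  move: (q1near) => /near_cabsP[e e0 eq1]; apply/dnear_cabsP; exists e => // w ws0 we.
  by apply: mero_quot_derivable; rewrite q1E mulf_neq0 ?eq1// expf_neq0// subr_eq0.
have Fpole : (k < m)%N -> pole F s0.
  move=> km'; split=> //; apply/cvgryPge => A.
  have G0 : 0 < cabs (G s0).
    by rewrite lt_neqAle cabs_ge0 eq_sym cabs_eq0 mulf_neq0 ?invr_eq0 ?h10.
  pose c := cabs (G s0) / 2; have c0 : 0 < c by rewrite divr_gt0.
  have /derivable_continuous/cvgrPdist_lt/(_ c%:C) := Gd _ q10.
  rewrite ltcR => /(_ c0) Gc.
  have {Gc} /near_cabsP[e e0 eG] : \forall w \near (s0 : C), q1 w != 0 /\ `|G s0 - G w| < c%:C.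
    exact: filterI q1near Gc.
  have A1 : 0 < `|A| + 1 by rewrite ltr_wpDl.
  (* The modulus of [G] stays above [c] within [e]. The bound 1 reduces the power [m - k] to the
     first power, and the last bound then pushes the quotient above [A]. *)
  apply/dnear_cabsP; exists (Num.min e (Num.min 1 (c / (`|A| + 1)))).
    by rewrite !lt_min e0 ltr01 divr_gt0.
  move=> w ws0; rewrite !lt_min => /and3P[we w1 wA].
  have [q1w] := eG w we; rewrite normc_cabs ltcR => Gw.
  rewrite -/(cabs (F w)) FE// cabsM cabsV cabsX.
  have cw : 0 < cabs (w - s0).
    by rewrite lt_neqAle cabs_ge0 eq_sym cabs_eq0 subr_eq0 ws0.
  have cG : c <= cabs (G w).
    have {}Gw : cabs (G s0 - G w) < c := Gw.
    have := cabsD (G s0 - G w) (G w); rewrite subrK => Gs0.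
    by rewrite /c in Gw *; lra.
  have cX : cabs (w - s0) ^+ (m - k) <= cabs (w - s0).
    by rewrite -[leRHS]expr1 ler_wiXn2l ?cabs_ge0 ?ltW// subn_gt0.
  rewrite ler_pdivlMr ?exprn_gt0//.
  apply: le_trans cG; apply: (@le_trans _ _ ((`|A| + 1) * cabs (w - s0))).
    apply: (@le_trans _ _ ((`|A| + 1) * cabs (w - s0) ^+ (m - k))).
      by rewrite ler_wpM2r ?exprn_ge0 ?cabs_ge0// (le_trans (ler_norm _))// lerDl.
    by rewrite ler_wpM2l// ltW.
  by rewrite mulrC -ler_pdivlMr// ltW.
split; last first.
  move=> hs0; apply: Fpole; rewrite ltnNge; apply/negP => mk.
  have k_gt0 := leq_trans m_gt0 mk.
  by move: hs0; rewrite h1E subrr expr0n gtn_eqF// mul0r eqxx.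
have [km'|mk] := ltnP k m; first by right; exact: Fpole.
have {km mk FE} FE w : w != s0 -> q1 w != 0 -> F w = G w.
  by move=> ws0 q1w; rewrite FE// (eqP mk) expr0 divr1.
(* The limit in [mero_quot] now exists and supplies the value of [G] at [s0]. *)
left; have Fs0 : F s0 = G s0.
  rewrite /mero_quot qs0 eqxx; apply: (@cvg_lim C); first exact: norm_hausdorff.
  have /derivable_continuous/continuous_withinNx Gc := Gd _ q10.
  apply: cvg_trans Gc; apply: near_eq_cvg.
  move: (q1near) => /near_cabsP[e e0 eq1]; apply/dnear_cabsP; exists e => // w ws0 we.
  rewrite -FE ?eq1// /mero_quot ifF// q1E; apply/negbTE.
  by rewrite mulf_neq0 ?eq1// expf_neq0// subr_eq0.
have FG : \forall w \near (s0 : C), G w = F w.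
  by move: q1near; apply: filterS => w q1w; have [->//|ws0] := eqVneq w s0; rewrite FE.
(* Holomorphy asks for derivability at all nearby points, hence for [G] and [F] to agree around each
   of them. *)
move: q1near (near_join FG); apply: filterS2 => w q1w.
exact: derivable_near_eq (Gd _ q1w).
Qed.

Lemma mero_quot_meromorphic : meromorphic F.
Proof.
move=> s; have [qs|qs] := eqVneq (q s) 0; first exact: (mero_quot_singular qs).1.
by left; exact: (mero_quot_regular qs).1.
Qed.

End Quotient.
End MeromorphicQuotient.

(** * Lattice strings *)

Lemma fsbigT_seq (V : nmodType) (I : choiceType) (s : seq I) (F : I -> V) :
  uniq s -> (forall i, i \notin s -> F i = 0) ->
  \sum_(i \in [set: I]) F i = \sum_(i <- s) F i.
Proof.
move=> us F0; rewrite [RHS]fsbig_seq// -(fsbig_widen [set` s] [set: I])// => i [_ /= /negP].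
exact: F0.
Qed.

(** Sums over the coefficients of [q] instead of up to [n], the shape shared by the linear
    recurrence and by [big_words]. The condition [j < n] covers the initial indices. *)
Lemma pconv_bounded (F : fieldType) (q : {poly F}) (u : nat -> F) d n :
  (size q <= d.+1)%N ->
  pconv q u n = q`_0 * u n + \sum_(j < d | (j < n)%N) q`_j.+1 * u (n - j.+1)%N.
Proof.
move=> qd; rewrite /pconv big_ord_recl subn0; congr (_ + _).
under eq_bigr do rewrite lift0.
have E : \sum_(i < n) q`_i.+1 * u (n - i.+1)%N =
    \sum_(i < n | (i < d)%N) q`_i.+1 * u (n - i.+1)%N.
  rewrite [LHS](bigID (fun i : 'I_n => (i < d)%N))/= [X in _ + X]big1 ?addr0// => i.
  by rewrite -leqNgt => di; rewrite nth_default ?mul0r// (leq_trans qd).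
rewrite E; have [nd|/ltnW dn] := leqP n d.
  rewrite -(big_ord_widen d (fun i => q`_i.+1 * u (n - i.+1)%N) nd).
  by apply: eq_bigl => i; rewrite (leq_trans (ltn_ord i) nd).
rewrite -(big_ord_widen n (fun i => q`_i.+1 * u (n - i.+1)%N) dn).
by apply/esym/eq_bigl => i; rewrite (leq_trans (ltn_ord i) dn).
Qed.

Section Words.
Variable N : nat.

(** Letters start at 0 and letter [j] has ratio r^(j+1), so r_J is r to the power [weight J]. *)
Definition weight (J : seq 'I_N) : nat := (\sum_(j <- J) (j : nat).+1)%N.

(* [k] is fuel; [n <= k] suffices. *)
Fixpoint words_rec k n : seq (seq 'I_N) :=
  if n is 0 then [:: [::]] else
  if k is k'.+1 then
    [seq j :: J | j : 'I_N <- enum 'I_N, J : seq 'I_N <- if (j < n)%N then words_rec k' (n - j.+1)%N else [::]]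
  else [::].

Definition words n := words_rec n n.

Lemma mem_words_rec k n J : (n <= k)%N -> (J \in words_rec k n) = (weight J == n).
Proof.
elim: k n J => [|k IH] [|n] J //= nk.
- by case: J => [|j J]; rewrite /weight ?big_nil ?big_cons.
- by case: J => [|j J]; rewrite /weight ?big_nil ?big_cons.
apply/allpairsPdep/eqP => [[j [K [_]]]|].
  case: ifP => // jn; rewrite IH; last by rewrite subSS (leq_trans (leq_subr _ _)).
  by move=> /eqP KE ->; rewrite /weight big_cons -/(weight K) KE subnKC.
case: J => [|j J]; first by rewrite /weight big_nil.
rewrite /weight big_cons -/(weight J) => JE.
have jn : (j < n.+1)%N by rewrite -JE leq_addr.
exists j, J; rewrite jn mem_enum; split=> //.
rewrite IH; last by rewrite subSS (leq_trans (leq_subr _ _)).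
by rewrite -JE addKn.
Qed.

Lemma mem_words n J : (J \in words n) = (weight J == n).
Proof. exact: mem_words_rec. Qed.

Lemma words_rec_uniq k n : uniq (words_rec k n).
Proof.
elim: k n => [|k IH] [|n] //.
apply: allpairs_uniq_dep => [|j _|[j J] [j' J'] _ _ /= [-> ->]//].
- exact: enum_uniq.
- by case: ifP.
Qed.

Lemma words_recE k n : (n <= k)%N -> perm_eq (words_rec k n) (words n).
Proof.
move=> nk; apply: uniq_perm; rewrite ?words_rec_uniq// => J.
by rewrite mem_words_rec// mem_words.
Qed.

(** Splitting off the first letter gives a linear recurrence for the total multiplicity of the words
    of given weight. *)
Lemma big_words (V : pzRingType) (m : 'I_N -> V) n :
  \sum_(J <- words n.+1) \prod_(j <- J) m j =
  \sum_(j < N | (j < n.+1)%N) m j * \sum_(J <- words (n.+1 - j.+1)%N) \prod_(i <- J) m i.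
Proof.
rewrite /words /= big_allpairs_dep big_enum/= [RHS]big_mkcond.
apply: eq_bigr => j _; case: ifP => jn; last by rewrite big_nil.
under eq_bigr do rewrite big_cons.
(* The recursive call may carry more fuel than [words] does, and the lists are compared up to
   permutation only. *)
rewrite -mulr_sumr; congr (_ * _); apply: perm_big.
by apply: words_recE; rewrite subSS leq_subr.
Qed.

End Words.

Section PowerAtoms.
Variables (R : realType) (r : R).
Hypothesis r01 : 0 < r < 1.

Lemma atomic_intro (V : pzRingType) (x : nat -> R) (eta : set R -> V) (c : nat -> V) :
  (forall A, bounded_borel A -> exists N0 : nat,
    (forall n, (N0 <= n)%N -> ~ A (x n)) /\
    exists2 N, (N0 <= N)%N & eta A = \sum_(n < N) c n * \1_A (x n)) ->
  atomic x eta c.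
Proof.
move=> h A /h[N0 [AN0 [N N0N ->]]]; exists N => M NM.
rewrite (big_ord_widen M (fun n => c n * \1_A (x n)) NM).
rewrite big_mkcond; apply: eq_bigr => n _; case: ltnP => // Nn.
by rewrite indicE memNset ?mulr0//; apply: AN0; exact: leq_trans Nn.
Qed.

Lemma exp_lt_eventually (e : R) : 0 < e -> exists N, forall n, (N <= n)%N -> r ^+ n < e.
Proof.
move=> e0; have /andP[r0 r1] := r01.
have := @cvg_expr R r; rewrite ger0_norm ?ltW// => /(_ r1)/cvgrPdist_lt/(_ _ e0)[N _ rN].
exists N => n Nn; have := rN n Nn; rewrite /= sub0r normrN.
by rewrite ger0_norm// exprn_ge0// ltW.
Qed.

(** One cutoff serves all gaps [b] up to [B]: the atoms are at least 1/(B r^n), which eventually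
    exceeds any bound of [A]. *)
Lemma bounded_atoms (B : R) (A : set R) : 0 < B -> bounded_borel A ->
  exists N, forall n (b : R), (N <= n)%N -> 0 < b <= B -> ~ A (b^-1 * r ^- n).
Proof.
move=> B0 [_ [M AM]]; have /andP[r0 r1] := r01.
have M1 : 0 < `|M| + 1 by rewrite ltr_wpDl.
have [|N rN] := @exp_lt_eventually ((B * (`|M| + 1))^-1); first by rewrite invr_gt0 mulr_gt0.
exists N => n b Nn /andP[b0 bB] /AM; rewrite /= in_itv/= => /andP[_].
apply/negP; rewrite -ltNge -invfM -[ltLHS]invrK.
have := rN n Nn; have rn0 : 0 < r ^+ n by rewrite exprn_gt0.
move=> rnB; apply: (@lt_le_trans _ _ (`|M| + 1)); first by rewrite invrK (le_lt_trans (ler_norm _))// ltrDl.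
rewrite -[leLHS]invrK lef_pV2 ?posrE ?invr_gt0 ?mulr_gt0//.
apply: (@le_trans _ _ (B * r ^+ n)); first by rewrite ler_wpM2r// ltW.
by move: rnB; rewrite invfM mulrC => rnB; rewrite mulrC -ler_pdivlMr// ltW.
Qed.

(** Words of equal weight share one atom and are grouped. On a bounded set only the finitely many
    words of weight below the cutoff count. *)
Lemma self_similar_atomic N (m : N.-tuple R[i]) :
  atomic (fun n => r ^- n)
    (self_similar_string [tuple 1] [tuple r ^+ (j : nat).+1 | j < N] m)
    (fun n => \sum_(J <- words N n) \prod_(j <- J) tnth m j).
Proof.
apply: atomic_intro => A bA; have [N0 AN0] := bounded_atoms ltr01 bA.
have {}AN0 n : (N0 <= n)%N -> ~ A (r ^- n).
  by move=> Nn; have := @AN0 n 1 Nn; rewrite ltr01 lexx invr1 mul1r; apply.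
exists N0; split=> //; exists N0 => //.
rewrite /self_similar_string big_ord1 tnth0 invr1.
have rJ (J : seq 'I_N) :
    (\prod_(j <- J) tnth [tuple r ^+ (j : nat).+1 | j < N] j) = r ^+ weight J.
  rewrite /weight; elim: J => [|j J IH]; first by rewrite !big_nil expr0.
  by rewrite !big_cons IH tnth_mktuple exprD.
under eq_fsbigr do rewrite rJ mul1r.
pose s := flatten [seq words N n | n <- iota 0 N0].
have memS J : (J \in s) = (weight J < N0)%N.
  apply/flatten_mapP/idP => [[n]|JN0].
    by rewrite mem_iota mem_words => + /eqP ->.
  by exists (weight J); rewrite ?mem_words// mem_iota.
rewrite (@fsbigT_seq _ _ s); first last.
- move=> J; rewrite memS -leqNgt => /AN0 nA; by rewrite indicE memNset ?mulr0.
- rewrite /s; elim: N0 {AN0 s memS} => // n IH.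
  rewrite -addn1 iotaD map_cat flatten_cat cat_uniq IH /= cats0 words_rec_uniq andbT.
  apply/hasPn => J; rewrite mem_words => /eqP JE; apply/negP => /flatten_mapP[k].
  by rewrite mem_iota mem_words JE => /andP[_ kn] /eqP nk; rewrite nk ltnn in kn.
rewrite /s big_flatten big_map -{1}(subn0 N0) -/(index_iota 0 N0) big_mkord.
apply: eq_bigr => n _; rewrite mulr_suml [LHS]big_seq [RHS]big_seq.
by apply: eq_bigr => J; rewrite mem_words => /eqP ->.
Qed.

End PowerAtoms.

(** * Recursive strings *)

Section Denominators.
Variable F : fieldType.

Definition kernel_poly d (a : d.-tuple F) : {poly F} :=
  \poly_(i < d.+1) (if i is j.+1 then - a`_j else 1).

Lemma kernel_poly0 d (a : d.-tuple F) : (kernel_poly a)`_0 = 1.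
Proof. by rewrite coef_poly. Qed.

(** From index [d] on, the coefficient of the product is exactly the defect in the recurrence, hence
    0. *)
Lemma pconv_recurrence d (a s0 : d.-tuple F) :
  exists p, pconv (kernel_poly a) (recurrence_seq a s0) = poly_series p.
Proof.
exists (\poly_(i < d) pconv (kernel_poly a) (recurrence_seq a s0) i).
apply/funext => n; rewrite /poly_series coef_poly; case: ltnP => // dn.
rewrite (pconv_bounded _ _ (size_poly _ _)) kernel_poly0 mul1r recurrence_seq_rec//.
under [X in _ + X]eq_bigl => j do rewrite (leq_trans (ltn_ord j) dn).
rewrite -big_split big1// => j _ /=.
by rewrite coef_poly ltnS ltn_ord mulNr subrr.
Qed.

Definition letter_multiplicities N (q : {poly F}) : N.-tuple F :=
  [tuple - q`_(j : nat).+1 | j < N].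

(** The free monoid on the letters gives a geometric series: the generating function of the words by
    weight is the inverse of 1 minus that of the letters, and the latter difference is [q]. *)
Lemma pconv_words N (q : {poly F}) : (size q <= N.+1)%N -> q`_0 = 1 ->
  pconv q (fun n => \sum_(J <- words N n) \prod_(j <- J) tnth (letter_multiplicities N q) j)
    = poly_series 1.
Proof.
move=> qN q0; apply/funext => n; rewrite (pconv_bounded _ _ qN) q0 mul1r /poly_series coef1.
case: n => [|n].
  by rewrite [X in _ + X]big_pred0// addr0 /words big_seq1 big_nil.
rewrite big_words -big_split big1// => j _ /=.
by rewrite tnth_mktuple mulNr addNr.
Qed.

Lemma pconv_Xn m (u : nat -> F) n :
  pconv 'X^m u n = if (m <= n)%N then u (n - m)%N else 0.
Proof.
rewrite /pconv; case: leqP => mn.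
  have mn' : (m < n.+1)%N by [].
  rewrite (bigD1 (Ordinal mn'))//= coefXn eqxx mul1r big1 ?addr0// => i im.
  by rewrite coefXn (_ : (_ == _) = false) ?mul0r//; apply/negbTE.
rewrite big1// => i _; rewrite coefXn (_ : (_ == _) = false) ?mul0r//.
by apply/negbTE; rewrite neq_ltn (leq_trans (ltn_ord i)).
Qed.

Lemma pconv_suml (I : Type) (r : seq I) (P : pred I) (p : I -> {poly F}) (u : nat -> F) n :
  pconv (\sum_(i <- r | P i) p i) u n = \sum_(i <- r | P i) pconv (p i) u n.
Proof.
elim/big_rec2: _ => [|i y q _ <-]; last by rewrite pconvDl.
by rewrite /pconv big1// => i _; rewrite coef0 mul0r.
Qed.

End Denominators.

Section RecursiveAtoms.
Variables (R : realType) (r : R).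
Hypothesis r01 : 0 < r < 1.

(** The half-open window is a fundamental domain for multiplication by [r]; the exponent is the
    least [n] with B r^(n+1) < g. *)
Lemma normalized_gap (B g : R) : 0 < g <= B ->
  exists (n : nat) (b : R), g = b * r ^+ n /\ B * r < b <= B.
Proof.
move=> /andP[g0 gB]; have B0 := lt_le_trans g0 gB; have /andP[r0 r1] := r01.
have exn : exists n, B * r ^+ n.+1 < g.
  have [|N rN] := exp_lt_eventually r01 (e := g / B); first by rewrite divr_gt0.
  by exists N; rewrite mulrC -ltr_pdivlMr// rN.
case: (ex_minnP exn) => n ng nmin; have rn0 : 0 < r ^+ n by rewrite exprn_gt0.
exists n, (g / r ^+ n); split; first by rewrite divfK// gt_eqF.
rewrite ltr_pdivlMr// ler_pdivrMr// -mulrA -exprS ng /=.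
case: n nmin {ng rn0} => [|n] nmin; first by rewrite mulr1.
by rewrite leNgt; apply/negP => /nmin; rewrite ltnn.
Qed.

(** Different exponents would put the larger multiple outside the window: b = b' r^i with i > 0
    forces b <= B r. *)
Lemma normalized_unique (B b b' : R) n n' : 0 < B -> B * r < b <= B -> B * r < b' <= B ->
  b * r ^+ n = b' * r ^+ n' -> b = b' /\ n = n'.
Proof.
move=> B0; have /andP[r0 r1] := r01.
wlog nn' : b b' n n' / (n <= n')%N => [wl bB bB' E|].
  have [nn'|/ltnW n'n] := leqP n n'; first exact: wl.
  by have [-> ->] := wl _ _ _ _ n'n bB' bB (esym E).
move=> /andP[b1 b2] /andP[b1' b2'].
rewrite -{1 2}(subnK nn') exprD mulrA => /mulIf; rewrite expf_neq0 ?gt_eqF// => /(_ isT).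
have [e|n0] := posnP (n' - n).
  by rewrite e mulr1 => <-; split=> //; apply/eqP; rewrite eqn_leq nn' -subn_eq0 e.
move=> bE; suff : b <= B * r by rewrite leNgt b1.
rewrite bE; apply: ler_pM => //; first by apply: ltW; apply: lt_trans b1'; exact: mulr_gt0.
  by rewrite exprn_ge0// ltW.
by rewrite -[leRHS]expr1 ler_wiXn2l// ltW.
Qed.

(** Gaps with the same normalized value [b] merge into one string, the shift by r^(n i) becoming a
    factor X^(n i) collected in [A]. The merging makes the atoms distinct, as the variation formulas
    require. *)
Lemma recursive_string_atomic d K (a s0 : d.-tuple R[i]) (g : K.-tuple R) :
  (0 < K)%N -> (forall k, 0 < tnth g k) ->
  exists (k : nat) (b : nat -> R) (A : nat -> {poly R[i]}),
    let x m := (b (m %% k)%N * r ^+ (m %/ k))^-1 in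
    [/\ (0 < k)%N, forall c, (c < k)%N -> 0 < b c, injective x &
        atomic x (recursive_string a s0 g r)
          (fun m => pconv (A (m %% k)%N) (recurrence_seq a s0) (m %/ k))].
Proof.
move=> K0 g0; have /andP[r0 r1] := r01; set s := recurrence_seq a s0.
pose B := \sum_(i < K) tnth g i.
have gB i : 0 < tnth g i <= B.
  by rewrite g0 /B (bigD1 i)//= lerDl sumr_ge0// => j _; exact: ltW.
have B0 : 0 < B by case/andP: (gB (Ordinal K0)); exact: lt_le_trans.
have /fin_all_exists[n /fin_all_exists[b bP]] := fun i => normalized_gap (gB i).
pose G := undup [seq b i | i <- enum 'I_K].
have bG i : b i \in G by rewrite mem_undup map_f// mem_enum.
pose k := size G; pose e := nth 0 G.
have eP c : (c < k)%N -> B * r < e c <= B.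
  move=> ck; have : e c \in G by exact: mem_nth.
  by rewrite mem_undup => /mapP[i _ ->]; exact: (bP i).2.
have e0 c : (c < k)%N -> 0 < e c.
  by move=> /eP/andP[+ _]; apply: lt_trans; exact: mulr_gt0.
have k0 : (0 < k)%N by rewrite /k (leq_ltn_trans (leq0n (index (b (Ordinal K0)) G)))// index_mem.
have idxP i : (index (b i) G < k)%N by rewrite index_mem.
pose idx i := Ordinal (idxP i).
pose A c : {poly R[i]} := \sum_(i < K | idx i == c :> nat) 'X^(n i).
exists k, e, A; split=> //.
  move=> m m' /invr_inj /(normalized_unique B0 (eP _ (ltn_pmod m k0)) (eP _ (ltn_pmod m' k0))).
  move=> [/eqP + mm']; rewrite nth_uniq ?undup_uniq ?ltn_pmod// => /eqP mm.
  by rewrite (divn_eq m k) (divn_eq m' k) mm mm'.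
apply: atomic_intro => E bE; have [N0 EN0] := bounded_atoms r01 B0 bE.
(* String [i] enters shifted by [n i]; lengthening the range by [M] retains at least [N0] terms of
   each. *)
pose M := (\sum_i n i)%N; have nM i : (n i <= M)%N by rewrite /M (bigD1 i)//= leq_addr.
exists (N0 * k)%N; split.
  move=> m N0m; rewrite invfM; apply: EN0; first by rewrite leq_divRL.
  have ck := ltn_pmod m k0; have /andP[_ ->] := eP _ ck.
  by rewrite e0.
exists ((N0 + M) * k)%N; first by rewrite leq_mul2r leq_addr orbT.
rewrite (blocked_sum k (fun m => pconv (A (m %% k)%N) s (m %/ k) *
  \1_E ((e (m %% k)%N * r ^+ (m %/ k))^-1))) exchange_big /=.
under eq_bigr => c _.
  under eq_bigr => j _.
    rewrite modnMDl divnMDl// modn_small// divn_small// addn0 /A pconv_suml mulr_suml.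
    over.
  rewrite exchange_big /=.
  over.
rewrite /recursive_string.
rewrite [LHS](partition_big idx xpredT)//=.
apply: eq_bigr => c _; apply: eq_big => [i|i ic]; first by rewrite -val_eqE.
have bc : e c = b i by rewrite -(eqP ic) /e /= nth_index.
under [RHS]eq_bigr do rewrite bc pconv_Xn.
have [gE _] := bP i.
have [M' M'E] : exists M', (N0 + M = n i + (N0 + M'))%N.
  by exists (M - n i)%N; rewrite addnCA subnKC.
rewrite M'E big_split_ord/= [X in _ = X + _]big1 ?add0r => [|j _]; last first.
  by rewrite leqNgt ltn_ord mul0r.
rewrite (@fsbigT_seq _ _ (iota 0 (N0 + M'))); first last.
- move=> j; rewrite mem_iota /= add0n -leqNgt => jN.
  rewrite indicE memNset ?mulr0//; apply: EN0; last exact: gB.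
  exact: leq_trans (leq_addr _ _) jN.
- exact: iota_uniq.
rewrite -{1}(subn0 (N0 + M')%N) -/(index_iota 0 _) big_mkord.
apply: eq_bigr => j _; rewrite leq_addr addKn gE; congr (_ * \1_E _).
by rewrite exprD -invfM mulrA.
Qed.

End RecursiveAtoms.

(** * Comparison of the zeta functions *)

Section ZetaOfAtoms.
Variable R : realType.
Implicit Types (s : R[i]) (sigma : R).

(** Makes each zeta function a combination of power series in r^s with factors b^s. *)
Lemma cpow_atom (b r : R) n s : 0 < b -> 0 < r ->
  cpow (b * r ^+ n)^-1 (- s) =
  cexp (s * ((ln b)%:C)%C) * cexp (s * ((ln r)%:C)%C) ^+ n.
Proof.
move=> b0 r0; have rn0 : 0 < r ^+ n by rewrite exprn_gt0.
rewrite cpow_cexp lnV ?posrE ?mulr_gt0// lnM ?posrE// lnXn// -cexpMn -cexpD.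
by congr cexp; rewrite rmorphN rmorphD rmorphMn /= mulrNN mulrDr mulrnAr.
Qed.

Lemma abs_summable_cabs_le (u : nat -> R[i]) (z w : R[i]) : cabs z <= cabs w ->
  abs_summable (fun n => u n * w ^+ n) -> abs_summable (fun n => u n * z ^+ n).
Proof.
move=> zw; apply: (@abs_summable_le _ _ _ 1) => // n.
by rewrite mul1r !cabsM !cabsX ler_wpM2l ?cabs_ge0// lerXn2r ?nnegrE ?cabs_ge0.
Qed.

Lemma cabs_cexp_ln (r : R) s : cabs (cexp (s * ((ln r)%:C)%C)) = expR (complex.Re s * ln r).
Proof. by rewrite cabs_cexp; case: s => a b /=; rewrite mulr0 subr0. Qed.

Lemma dimension_lt_summable (x : nat -> R) (eta : set R -> R[i]) (c : nat -> R[i]) (s : R) :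
  (forall n, 0 < x n) -> injective x -> atomic x eta c ->
  (dimension eta < s%:E)%E ->
  exists2 sigma : R, sigma < s &
    abs_summable (fun n => c n * cpow (x n) (- ((sigma%:C)%C))).
Proof.
move=> x0 xi etac /ereal_inf_lt[_ [sigma /= hs <-]]; rewrite lte_fin => ss.
by exists sigma => //; apply/(variation_integrable x0 xi sigma etac).
Qed.

(** The continuations are h/q and 1/q. A pole of h/q must be a zero of [q], and there 1/q has a pole
    because its numerator never vanishes. *)
Lemma quotient_continuation (etaR eta : set R -> R[i]) (h q : R[i] -> R[i]) :
  expandable h -> entire q ->
  (forall z, exists m (q1 : R[i] -> R[i]),
    [/\ forall s, derivable (q1 : R[i]^o -> R[i]^o) (s : R[i]^o) 1,
        forall s, q s = (s - z) ^+ m * q1 s & q1 z != 0]) ->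
  dimension etaR = dimension eta ->
  (forall s, (dimension eta < (complex.Re s)%:E)%E -> q s * geometric_zeta eta s = 1) ->
  (forall s, (dimension eta < (complex.Re s)%:E)%E ->
    geometric_zeta etaR s = h s * geometric_zeta eta s) ->
  let zetaR := mero_quot h q in let zeta_eta := mero_quot (fun=> 1) q in
  [/\ zeta_continuation etaR zetaR, zeta_continuation eta zeta_eta,
      forall s, ~ pole zeta_eta s -> zetaR s = h s * zeta_eta s &
      [set s | pole zetaR s] `<=` [set s | pole zeta_eta s]].
Proof.
move=> h_exp q_entire q_factor dimE eta_zeta etaR_zeta zetaR zeta_eta.
have one_exp := @expandable_cst R 1.
have quotE f s : q s != 0 -> mero_quot f q s = f s / q s.
  by move=> qs; rewrite /mero_quot (negbTE qs).
have one_pole s : q s = 0 -> pole zeta_eta s.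
  move=> qs; apply: (mero_quot_singular one_exp q_entire q_factor qs).2.
  exact: oner_neq0.
have qV s : (dimension eta < (complex.Re s)%:E)%E ->
    q s != 0 /\ geometric_zeta eta s = (q s)^-1.
  move=> /eta_zeta E; have qs : q s != 0.
    by apply: contra_eq_neq E => ->; rewrite mul0r eq_sym oner_neq0.
  by split=> //; rewrite -[LHS](mulKf qs) E mulr1.
split.
- split; first exact: mero_quot_meromorphic.
  move=> s; rewrite dimE => ds; have [qs zE] := qV s ds.
  by rewrite /zetaR quotE// etaR_zeta// zE.
- split; first exact: mero_quot_meromorphic.
  by move=> s /qV[qs ->]; rewrite /zeta_eta quotE// div1r.
- move=> s Hs; have qs : q s != 0 by apply/eqP => /one_pole.
  by rewrite /zetaR /zeta_eta !quotE// div1r.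
- move=> s /= Hs; apply: one_pole; apply/eqP; apply/negPn/negP => qs.
  exact: (mero_quot_regular h_exp q_entire qs).2.
Qed.

End ZetaOfAtoms.

Theorem corollary4p14 (R : realType) (d K : nat)
    (a : d.-tuple R[i]) (s0 : d.-tuple R[i]) (g : K.-tuple R) (r : R)
    (hd : (0 < d)%N) (had : a`_d.-1 != 0) (hK : (0 < K)%N)
    (hg : forall k : 'I_K, 0 < tnth g k) (hr : 0 < r < 1) :
  exists (eta : set R -> R[i]) (h zetaR zeta_eta : R[i] -> R[i]),
    [/\ generalized_lattice_string eta,
        entire h,
        zeta_continuation (recursive_string a s0 g r) zetaR,
        zeta_continuation eta zeta_eta
      & [/\ forall s : R[i], ~ pole zeta_eta s -> zetaR s = h s * zeta_eta s,
            dimension (recursive_string a s0 g r) = dimension eta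
          & [set s | pole zetaR s] `<=` [set s | pole zeta_eta s]]].
Proof.
have /andP[r0 r1] := hr; have lnr : ln r != 0 by rewrite lt_eqF// ln_lt0.
have [p pE] := pconv_recurrence a s0.
have [k [b [A]]] := recursive_string_atomic hr a s0 hK hg.
set x := fun m => _; set w := fun m => _ => -[k0 b0 x_inj etaR_atomic].
pose t (c : 'I_k) := pconv (A c) (recurrence_seq a s0).
have tE c : pconv (kernel_poly a) (t c) = poly_series (A c * p).
  by rewrite /t -pconvM mulrC pconvM pE pconv_poly_series.
have [q [p' [qa q0 qP]]] := reduced_denominator (kernel_poly0 a) tE.
have {qa} qd : (size q <= d.+1)%N := leq_trans qa (size_poly _ _).
pose m := letter_multiplicities d q.
pose u n := \sum_(J <- words d n) \prod_(j <- J) tnth m j.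
have uE : pconv q u = poly_series 1 := pconv_words qd q0.
have {qP} [tpE uS] := qP u uE.
(* All [d] letters are kept, with multiplicity 0 beyond the degree of [q], so the alphabet is
   nonempty even if [q] is constant. *)
pose eta := self_similar_string [tuple 1] [tuple r ^+ (j : nat).+1 | j < d] m.
have eta_atomic : atomic (fun n => r ^- n) eta u := self_similar_atomic hr m.
pose Z (s : R[i]) := cexp (s * ((ln r)%:C)%C).
pose Q s := q.[Z s].
pose h s := \sum_(c < k) cexp (s * ((ln (b c))%:C)%C) * (p' c).[Z s].
have x_gt0 n : 0 < x n.
  by rewrite invr_gt0 mulr_gt0 ?exprn_gt0// b0// ltn_pmod.
have y_gt0 n : 0 < r ^- n by rewrite invr_gt0 exprn_gt0.
(* The window (r, 1] with both normalized gaps equal to 1. *)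
have y_inj : injective (fun n => r ^- n).
  move=> i j /invr_inj; rewrite -[r ^+ i]mul1r -[r ^+ j]mul1r.
  have h1 : (1 * r < 1) && (1 <= 1 :> R) by rewrite mul1r r1 /=.
  by move=> /(normalized_unique hr ltr01 h1 h1)[].
have wE s n (c : 'I_k) : w (n * k + c)%N * cpow (x (n * k + c)%N) (- s) =
    cexp (s * ((ln (b c))%:C)%C) * (t c n * Z s ^+ n).
  rewrite /w /x modnMDl divnMDl// modn_small// divn_small// addn0.
  by rewrite cpow_atom ?b0// /t; ring.
have yE s n : u n * cpow (r ^- n) (- s) = u n * Z s ^+ n.
  by rewrite -[r ^+ n]mul1r cpow_atom// ln1 mulr0 cexp0 mul1r.
have etaR_summable s : abs_summable (fun n => w n * cpow (x n) (- s)) <->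
    forall c, abs_summable (fun n => t c n * Z s ^+ n).
  rewrite (abs_summable_blocks _ k0); split=> H c.
    apply: (@abs_summable_eq _ ((cexp (s * ((ln (b c))%:C)%C))^-1 \*o
      (fun n => w (n * k + c)%N * cpow (x (n * k + c)%N) (- s)))) => [n|].
      by rewrite /= wE mulKf// cexp_neq0.
    exact: abs_summableZ.
  apply: (@abs_summable_eq _ (cexp (s * ((ln (b c))%:C)%C) \*o
    (fun n => t c n * Z s ^+ n))) => [n|]; first by rewrite wE.
  exact: abs_summableZ.
(* Each [t c] is a polynomial multiple of [u], and by Bezout [u] is a combination of 1 and the
   [t c]. *)
have summable_iff s : (forall c, abs_summable (fun n => t c n * Z s ^+ n)) <->
    abs_summable (fun n => u n * Z s ^+ n).
  split=> [tS|S c]; last by rewrite tpE; exact: abs_summable_pconv.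
  apply: (uS (fun y => abs_summable (fun n => y n * Z s ^+ n))) => //.
  - by move=> A' y; exact: abs_summable_pconv.
  - move=> y z yS zS; apply: abs_summable_eq (abs_summableD yS zS) => n.
    by rewrite /= mulrDl.
  - by apply: (@abs_summable_finite _ _ 1) => -[//|n] _; rewrite /poly_series coef1 mul0r.
have y_summable s : abs_summable (fun n => u n * cpow (r ^- n) (- s)) <->
    abs_summable (fun n => u n * Z s ^+ n).
  by split; apply: abs_summable_eq => n; rewrite yE.
(* The two sets of admissible exponents coincide, so the infima agree without being computed. *)
have dimE : dimension (recursive_string a s0 g r) = dimension eta.
  rewrite /dimension; congr (ereal_inf [set sigma%:E | sigma in _]).
  apply/funext => sigma; apply/propext => /=.
  rewrite (variation_integrable x_gt0 x_inj sigma etaR_atomic).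
  rewrite (variation_integrable y_gt0 y_inj sigma eta_atomic).
  by rewrite etaR_summable summable_iff y_summable.
(* The infimum provides some admissible [sigma] below the real part of [s]; as ln r < 0, the modulus
   of [Z] is smaller at [s]. *)
have dim_lt s : (dimension eta < (complex.Re s)%:E)%E ->
    abs_summable (fun n => u n * Z s ^+ n).
  move=> /(dimension_lt_summable y_gt0 y_inj eta_atomic)[sigma ss /y_summable].
  apply: abs_summable_cabs_le; rewrite !cabs_cexp_ln ler_expR.
  by apply: ler_wnM2r (ltW ss); rewrite ltW// ln_lt0.
have zeta_sum s : abs_summable (fun n => u n * Z s ^+ n) ->
    has_sum (fun n => u n * Z s ^+ n) (geometric_zeta eta s).
  move=> S; have [mRe mIm] := measurable_cpow (- s).
  have := has_sum_integral_complex y_gt0 y_inj eta_atomic mRe mIm ((y_summable s).2 S).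
  by apply: has_sum_eq => n; exact: yE.
(* Multiplying the series of [u] by [q] leaves the constant series 1, on the level of sums as
   well. *)
have zeta_etaE s : abs_summable (fun n => u n * Z s ^+ n) -> Q s * geometric_zeta eta s = 1.
  move=> S; have := @has_sum_pconv _ q _ _ _ (zeta_sum s S); rewrite uE => h1.
  apply: (has_sum_unique h1).
  have := @has_sum_finite _ (fun n => poly_series 1 n * Z s ^+ n) 1.
  rewrite big_ord1 /poly_series coef1 expr0 mulr1; apply=> -[//|n] _.
  by rewrite coef1 mul0r.
have zetaRE s : abs_summable (fun n => u n * Z s ^+ n) ->
    geometric_zeta (recursive_string a s0 g r) s = h s * geometric_zeta eta s.
  move=> S; have [mRe mIm] := measurable_cpow (- s).
  have /etaR_summable S' := (summable_iff s).2 S.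
  have zR : has_sum _ (geometric_zeta (recursive_string a s0 g r) s) :=
    has_sum_integral_complex x_gt0 x_inj etaR_atomic mRe mIm S'.
  rewrite /h mulr_suml; apply: (has_sum_blocks k0 zR) => c; rewrite -mulrA.
  have zc := @has_sumZ _ (cexp (s * ((ln (b c))%:C)%C)) _ _
    (@has_sum_pconv _ (p' c) _ _ _ (zeta_sum s S)).
  apply: (@has_sum_eq _ _ _ _ _ zc) => n.
  by rewrite /= -tpE wE.
have q_neq0 : q != 0 by apply: contra_eq_neq q0 => ->; rewrite coef0 eq_sym oner_neq0.
have Zexp : expandable Z := expandable_cexp (ln r).
have hexp : expandable h.
  apply: expandable_sum => c; apply: expandableM (expandable_cexp _) _.
  exact: expandable_horner.
have Q_entire : entire Q := (expandable_horner q Zexp).1.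
have Q_factor z := horner_cexp_factor z q_neq0 lnr.
have [zetaR_cont zeta_cont zetaE polesS] := quotient_continuation hexp Q_entire
  Q_factor dimE (fun s ds => zeta_etaE s (dim_lt s ds)) (fun s ds => zetaRE s (dim_lt s ds)).
exists eta, h, (mero_quot h Q), (mero_quot (fun=> 1) Q).
split; [|exact: hexp.1|exact: zetaR_cont|exact: zeta_cont|by split].
exists 1%N, d, [tuple 1], [tuple r ^+ (j : nat).+1 | j < d], m.
split; [exact: isT|exact: hd| | |split; last exact: erefl].
- by move=> l; rewrite (ord1 l) tnth0 ltr01.
- by move=> j; rewrite tnth_mktuple exprn_gt0 ?exprn_ilt1 ?ltW.
- exists r; split; first exact: hr.
  by move=> j; exists (j : nat).+1; [exact: isT|rewrite tnth_mktuple].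
Qed.
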